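(* Let $r\geq 3$ and let $\mathfrak{b}$ be a Borel subalgebra of the complex orthogonal Lie algebra $\mathfrak{o}_{2r+1}$ (simple of type $B_r$). For every integer $m\ge 0$, the number of abelian ideals of $\mathfrak{b}$ of dimension $m$ is equal to the coefficient of $t^m$ in the polynomial $$f_{B_r}(t)=t^{2r-1}+\sum_{k=0}^{r-2}t^{2r-k-2}\prod_{j=1}^{k}(1+t^j)+\prod_{j=1}^{r-1}(1+t^j).$$
   Context: An abelian ideal of $\mathfrak{b}$ is an ideal $I$ of the Lie algebra $\mathfrak{b}$ with $[I,I]=0$ (the zero ideal is included); dimension is over $\mathbb{C}$. An empty product equals $1$. *)

(* Defs.v *)
From HB Require Import structures.
From mathcomp Require Import all_boot all_order all_algebra.
From mathcomp Require Import classical_sets cardinality reals.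
From mathcomp Require Import complex.

Set Implicit Arguments.
Unset Strict Implicit.
Unset Printing Implicit Defensive.

Import GRing.Theory.

Local Open Scope ring_scope.

Section MatrixLieAlgebras.
Variables (F : fieldType) (n : nat).
Implicit Types (x y : 'M[F]_n) (U V W g b c I : {vspace 'M[F]_n}).

Definition lie_bracket x y : 'M[F]_n := x *m y - y *m x.

(* [U, V]; bases suffice by bilinearity, see lie_prod_subvP. *)
Definition lie_prod U V : {vspace 'M[F]_n} :=
  <<[seq lie_bracket x y | x <- vbasis U, y <- vbasis V]>>%VS.

Definition lie_subalgebra U : Prop :=
  forall x y, x \in U -> y \in U -> lie_bracket x y \in U.

Definition derived_series (k : nat) U : {vspace 'M[F]_n} :=
  iter k (fun V => lie_prod V V) U.

Definition lie_solvable U : Prop := exists k, derived_series k U = 0%VS.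

Definition borel_subalgebra g b : Prop :=
  [/\ (b <= g)%VS, lie_subalgebra b, lie_solvable b &
      forall c, (c <= g)%VS -> lie_subalgebra c -> lie_solvable c ->
        (b <= c)%VS -> c = b].

Definition lie_ideal b I : Prop :=
  (I <= b)%VS /\ forall x y, x \in b -> y \in I -> lie_bracket x y \in I.

Definition abelian_ideal b I : Prop :=
  lie_ideal b I /\ forall x y, x \in I -> y \in I -> lie_bracket x y = 0.

(* The orthogonal Lie algebra of the standard form \sum_i u_i v_i. *)
Definition orthogonal_lie : {vspace 'M[F]_n} :=
  lker (linfun (fun x : 'M[F]_n => x + x^T)).

Lemma lie_prod_subvP U V W :
  reflect (forall x y, x \in U -> y \in V -> lie_bracket x y \in W)
          (lie_prod U V <= W)%VS.
Proof.
apply: (iffP span_subvP) => [sW x y Ux Vy | sW z].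
  rewrite (coord_vbasis Ux) (coord_vbasis Vy) /lie_bracket mulmx_suml mulmx_sumr.
  rewrite -sumrB rpred_sum // => i _.
  rewrite mulmx_sumr mulmx_suml -sumrB rpred_sum // => j _.
  rewrite -!scalemxAl -!scalemxAr [in X in _ - X]scalerA [_ * coord _ i _]mulrC.
  rewrite -scalerA -!scalerBr !rpredZ //; apply/sW/allpairsP.
  by exists ((vbasis U)`_i, (vbasis V)`_j); rewrite !mem_nth ?size_tuple.
case/allpairsP=> -[x y] /= [Ux Vy ->].
by apply: sW; apply: vbasis_mem.
Qed.

Lemma mem_orthogonal_lie x : (x \in orthogonal_lie) = (x^T == - x).
Proof.
have lin_f : linear (fun x : 'M[F]_n => x + x^T).
  by move=> a u v; rewrite linearP /= scalerDr addrACA.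
pose f : {linear 'M[F]_n -> 'M[F]_n} :=
  HB.pack (fun x : 'M[F]_n => x + x^T)
    (GRing.isLinear.Build _ _ _ _ _ lin_f).
by rewrite memv_ker (lfunE f) /= addrC addr_eq0.
Qed.

End MatrixLieAlgebras.

Definition fB (r : nat) : {poly nat} :=
  'X^(2 * r - 1)
  + \sum_(0 <= k < r.-1) 'X^(2 * r - k - 2) * \prod_(1 <= j < k.+1) (1 + 'X^j)
  + \prod_(1 <= j < r) (1 + 'X^j).

(* Main.v *)
From HB Require Import structures.
Require Import Defs.
From mathcomp Require Import all_boot all_order all_algebra.
From mathcomp Require Import classical_sets cardinality reals.
From mathcomp Require Import complex.
From mathcomp Require Import ring zify.

Set Implicit Arguments.
Unset Strict Implicit.
Unset Printing Implicit Defensive.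

Import Order.TTheory GRing.Theory Num.Theory.

Local Open Scope ring_scope.

(** The proof identifies every Borel subalgebra with one triangular model,
    reads abelian ideals of the model as strict partitions, and counts those.

    The model.  A Borel subalgebra b is solvable, so by Lie's theorem
    ([lie_theorem]) it has common eigenvectors in every invariant subspace.
    Skewness forces the eigenvalues at a non-isotropic eigenvector to vanish;
    hence two orthogonal non-isotropic eigenvectors can be combined into an
    isotropic one, and an isotropic common eigenvector v always exists in
    dimension at least 2 ([isotropic_eigenvector]).  Passing to the
    orthogonal space of a hyperbolic plane through v and inducting gives a
    basis in which the form is antidiagonal and b is upper triangular
    ([skew_triangularization]).  The algebra of all upper triangular matrices
    that are skew for the antidiagonal form is itself solvable, so by
    maximality b is conjugate to all of it ([borel_conj]).

    Ideals.  Index rows and columns by 0, .., 2r.  A skew matrix is determined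
    by its entries (i, j) with i + j < 2r, and the positive roots are the
    positions with moreover i < j: row i of this staircase has 2r - 1 - 2i of
    them.  Bracketing with diagonal matrices acts on the entries by weights
    that separate the positive roots, so an ideal contains the root vector of
    every position at which one of its members is nonzero
    ([ideal_root_component]); an abelian ideal moreover has no diagonal part
    ([abelian_ideal_diag0]).  Bracketing with root vectors closes the set of
    positions under moving up and to the right.  Therefore row i of an abelian
    ideal consists of the last l_i positions of the row, and l_0 > l_1 > ..
    as long as the rows are nonempty: l is a strict partition.  If l_1 > 0,
    commutativity amounts to l_0 + l_1 <= 2r - 2 ([abelian_root_rows] and
    [shape_product0]), and this bound already implies all the constraints
    l_i <= 2r - 1 - 2i except l_0 <= 2r - 1.  The dimension of the ideal is
    the sum of the parts ([dim_shape_space]).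

    Counting.  Strict partitions with parts at most k have generating
    polynomial (1 + t) .. (1 + t^k).  The admissible l are the one-row
    partition (2r - 1); those with l_0 = 2r - 2 - k for some k <= r - 2, whose
    remaining parts form any strict partition with parts at most k; and those
    with l_0 <= r - 1, for which the bound on l_0 + l_1 is automatic.  These
    are the three summands of the polynomial ([abelian_partitions_gen]). *)

(** * Lie's theorem *)

Lemma stable_eigenvector (F : numClosedFieldType) d (W Z : 'M[F]_d) :
  W != 0 -> stablemx W Z ->
  exists (v : 'rV_d) (a : F), [/\ v != 0, (v <= W)%MS & v *m Z = a *: v].
Proof.
move=> W0; rewrite -stablemx_row_base => /submxP[Z' defZ'].
have rW : (0 < \rank W)%N by rewrite lt0n mxrank_eq0.
have [a /eigenvalueP[u uZ u0]] := eigenvalue_closed Z' rW.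
exists (u *m row_base W), a; split.
- by rewrite mulmx_free_eq0 // row_base_free.
- by rewrite (submx_trans (submxMl _ _)) // eq_row_base.
- by rewrite -mulmxA defZ' mulmxA uZ -scalemxAl.
Qed.

(** The invariance step of Lie's theorem, without traces.  Let C j be the
    span of v, v Z, .., v Z^(j-1), and m + 1 the length at which this chain
    becomes stationary.  An element k of K acts on the chain triangularly with
    diagonal lam k, and the entries next to the diagonal are, up to sign, the
    multiples 1, 2, 3, .. of lam [k, Z].  Applying k to v Z^(m+1), which lies
    in C (m+1), and comparing the coefficients of v Z^m modulo C m gives
    (m + 1) lam [k, Z] = 0.  In characteristic 0 this makes lam vanish on
    [K, Z], and then every v Z^j has weight lam. *)
Section WeightInvariance.
Variables (F : numFieldType) (d : nat) (Z : 'M[F]_d) (K : 'M[F]_d -> Prop).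
Variables (lam : 'M[F]_d -> F) (v : 'rV[F]_d).
Hypothesis bracketK : forall k, K k -> K (lie_bracket k Z).
Hypothesis v_weight : forall k, K k -> v *m k = lam k *: v.
Hypothesis v_neq0 : v != 0.

Let w (j : nat) : 'rV[F]_d := iter j (mulmxr Z) v.
Let C (j : nat) : 'M[F]_d := (\sum_(i < j) <<w i>>)%MS.

Let wS j : w j.+1 = w j *m Z. Proof. by []. Qed.

Let w_in i j : (i < j)%N -> (w i <= C j)%MS.
Proof. by move=> ij; apply: (sumsmx_sup (Ordinal ij)); rewrite ?genmxE. Qed.

Let C_mono i j : (i <= j)%N -> (C i <= C j)%MS.
Proof.
move=> ij; apply/sumsmx_subP => k _; rewrite genmxE; apply: w_in.
exact: leq_trans (ltn_ord k) ij.
Qed.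

Let C_Z j (u : 'rV_d) : (u <= C j)%MS -> (u *m Z <= C j.+1)%MS.
Proof.
move=> uS; apply: submx_trans (submxMr Z uS) _.
rewrite sumsmxMr; apply/sumsmx_subP => k _.
by rewrite (eqmxMr Z (genmxE (w k))); apply: (w_in (i := k.+1)); rewrite ltnS.
Qed.

Let step j k : w j.+1 *m k = w j *m k *m Z - w j *m lie_bracket k Z.
Proof. by rewrite wS /lie_bracket mulmxBr !mulmxA opprB addrC subrK. Qed.

Let triangular j k : K k -> (w j *m k - lam k *: w j <= C j)%MS.
Proof.
elim: j k => [|j IHj] k Kk; first by rewrite v_weight // subrr sub0mx.
have -> : w j.+1 *m k - lam k *: w j.+1
    = (w j *m k - lam k *: w j) *m Z
      - (w j *m lie_bracket k Z - lam (lie_bracket k Z) *: w j)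
      - lam (lie_bracket k Z) *: w j.
  rewrite step mulmxBl -scalemxAl -wS.
  move: (w j *m k *m Z) (w j *m lie_bracket k Z) (w j) (w j.+1) => a b c e.
  by apply/rowP => i; rewrite !mxE; ring.
rewrite addmx_sub ?eqmx_opp ?scalemx_sub ?w_in //.
rewrite addmx_sub ?eqmx_opp ?C_Z ?IHj //.
by apply: submx_trans (C_mono (leqnSn j)); apply/IHj/bracketK.
Qed.

Let subtriangular j k : K k ->
  ((w j.+1 *m k - lam k *: w j.+1 + (lam (lie_bracket k Z) *+ j.+1) *: w j)%R
     <= C j)%MS.
Proof.
elim: j k => [|j IHj] k Kk.
  rewrite step (v_weight Kk) (v_weight (bracketK Kk)) -scalemxAl mulr1n wS.
  by rewrite [X in (X + _)%R]addrAC subrr sub0r addNr sub0mx.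
set mu := lam (lie_bracket k Z).
have -> : w j.+2 *m k - lam k *: w j.+2 + (mu *+ j.+2) *: w j.+1
    = (w j.+1 *m k - lam k *: w j.+1 + (mu *+ j.+1) *: w j) *m Z
      - (w j.+1 *m lie_bracket k Z - mu *: w j.+1).
  rewrite step mulmxDl mulmxBl -!scalemxAl -!wS.
  move: (w j.+1 *m k *m Z) (w j.+1 *m lie_bracket k Z) (w j.+1) (w j.+2).
  by move=> a b c e; apply/rowP => i; rewrite !mxE !mulrSr; ring.
by rewrite addmx_sub ?eqmx_opp ?C_Z ?IHj // triangular //; apply: bracketK.
Qed.

Let C_succ j : (C j.+1 :=: C j + w j)%MS.
Proof.
rewrite /C big_ord_recr /=; apply: adds_eqmx => //; exact: genmxE.
Qed.

Let cyclic_length :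
  exists2 m, (w m.+1 <= C m.+1)%MS & ~~ (w m <= C m)%MS.
Proof.
have rankC j : (forall i, (i < j)%N -> ~~ (w i <= C i)%MS) -> (j <= \rank (C j))%N.
  elim: j => // j IHj nin; apply: leq_ltn_trans (IHj _) _.
    by move=> i ij; apply: nin; apply: ltnW.
  rewrite C_succ; apply: rank_ltmx; rewrite ltmxE addsmxSl /=.
  by apply: contra (nin j _) => //; apply: submx_trans; apply: addsmxSr.
have [m m_in m_min] : exists2 m, (w m <= C m)%MS &
    forall i, (w i <= C i)%MS -> (m <= i)%N.
  suff ex : exists m, (w m <= C m)%MS.
    by exists (ex_minn ex); case: ex_minnP.
  have : ~~ [forall i : 'I_d.+1, ~~ (w i <= C i)%MS].
    apply/negP => /forallP nin; have := rank_leq_row (C d.+1).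
    by rewrite leqNgt rankC // => i id; apply: (nin (Ordinal id)).
  by case/forallPn => i; rewrite negbK; exists i.
case: m m_in m_min => [|m] m_in m_min.
  by move: m_in; rewrite /C big_ord0 submx0 (negPf v_neq0).
by exists m => //; apply/negP => /m_min; rewrite ltnn.
Qed.

Let lam_bracket k : K k -> lam (lie_bracket k Z) = 0.
Proof.
move=> Kk; have [m m_in m_nin] := cyclic_length; apply/eqP.
set mu := lam _; apply: contraR m_nin => mu0.
suff : ((mu *+ m.+1) *: w m <= C m)%MS.
  by rewrite eqmx_scale // -mulr_natr mulf_neq0 // pnatr_eq0.
have stepC (u : 'rV_d) : (u <= C m.+1)%MS -> (u *m k - lam k *: u <= C m)%MS.
  case/sub_sumsmxP => c ->; rewrite mulmx_suml scaler_sumr -sumrB.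
  apply: summx_sub => i _.
  have /submxP[a ->] : (c i *m <<w i>>%MS <= w i)%MS.
    by rewrite (submx_trans (submxMl _ _)) // genmxE.
  rewrite -mulmxA scalemxAr -mulmxBr (submx_trans (submxMl _ _)) //.
  by rewrite (submx_trans (triangular _ Kk)) // C_mono // -ltnS.
have h1 := subtriangular m Kk; have h2 := stepC _ m_in.
rewrite -[X in (X <= _)%MS](addKr (w m.+1 *m k - lam k *: w m.+1)).
by rewrite addmx_sub ?eqmx_opp.
Qed.

Lemma weight_space_invariant :
  exists W : 'M[F]_d, [/\ (v <= W)%MS, stablemx W Z &
    forall k, K k -> forall u : 'rV_d, (u <= W)%MS -> u *m k = lam k *: u].
Proof.
have [m m_in _] := cyclic_length; exists (C m.+1); split.
- exact: (w_in (i := 0)).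
- rewrite sumsmxMr; apply/sumsmx_subP => k _.
  rewrite (eqmxMr Z (genmxE (w k))) -wS.
  have := ltn_ord k; rewrite ltnS leq_eqVlt => /orP[/eqP-> //|km].
  exact: (w_in (i := k.+1)).
have wk j k : K k -> w j *m k = lam k *: w j.
  elim: j k => [|j IHj] k Kk; first exact: v_weight.
  rewrite step IHj // -scalemxAl -wS IHj; last exact: bracketK.
  by rewrite lam_bracket // scale0r subr0.
move=> k Kk u /sub_sumsmxP[c ->]; rewrite mulmx_suml scaler_sumr.
apply: eq_bigr => i _.
have /submxP[a ->] : (c i *m <<w i>>%MS <= w i)%MS.
  by rewrite (submx_trans (submxMl _ _)) // genmxE.
by rewrite -mulmxA wk // scalemxAr.
Qed.
End WeightInvariance.

Lemma lie_prodS (F : fieldType) n (U V U' V' : {vspace 'M[F]_n}) :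
  (U <= U')%VS -> (V <= V')%VS -> (lie_prod U V <= lie_prod U' V')%VS.
Proof.
move=> /subvP sU /subvP sV; apply/lie_prod_subvP => x y Ux Vy.
by apply: (lie_prod_subvP _ _ _ (subvv _)); [apply: sU | apply: sV].
Qed.

Lemma derived_seriesS (F : fieldType) n k (U V : {vspace 'M[F]_n}) :
  (U <= V)%VS -> (derived_series k U <= derived_series k V)%VS.
Proof. by move=> sUV; elim: k => //= k IHk; apply: lie_prodS. Qed.

Lemma lie_solvableS (F : fieldType) n (U V : {vspace 'M[F]_n}) :
  (U <= V)%VS -> lie_solvable V -> lie_solvable U.
Proof.
move=> sUV [k Vk]; exists k; apply/eqP; rewrite -subv0 -Vk.
exact: derived_seriesS.
Qed.

Lemma lie_solvable_perfect (F : fieldType) n (g : {vspace 'M[F]_n}) :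
  lie_solvable g -> (g <= lie_prod g g)%VS -> g = 0%VS.
Proof.
move=> [k gk] gg; apply/eqP; rewrite -subv0 -gk; elim: k {gk} => //= k IHk.
exact: subv_trans gg (lie_prodS IHk IHk).
Qed.

Lemma lie_bracketE (F : fieldType) n (x y : 'M[F]_n) :
  lie_bracket x y = x *m y - y *m x.
Proof. by []. Qed.

(** Any hyperplane above the derived algebra is an ideal, whence the
    induction on the dimension in Lie's theorem. *)
Lemma solvable_hyperplane (F : fieldType) n (g : {vspace 'M[F]_n}) :
  lie_subalgebra g -> lie_solvable g -> g != 0%VS ->
  exists (k : {vspace 'M[F]_n}) (z : 'M[F]_n),
    [/\ (lie_prod g g <= k)%VS, (k <= g)%VS, z \in g,
        (g <= k + <[z]>)%VS & (\dim k < \dim g)%N].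
Proof.
move=> lie_g sol_g g0; set D := lie_prod g g.
have sDg : (D <= g)%VS by apply/lie_prod_subvP.
have /subvPn[z gz Dz] : ~~ (g <= D)%VS.
  by apply: contra g0 => /(lie_solvable_perfect sol_g)/eqP.
have sDz : (D + <[z]> <= g)%VS by rewrite subv_add sDg -memvE.
set C := (g :\: (D + <[z]>))%VS.
have gE : (C + (D + <[z]>))%VS = g.
  by rewrite -[RHS](addv_diff_cap g (D + <[z]>)) (capv_idPr sDz).
exists (D + C)%VS, z; split=> //; first exact: addvSl.
- by rewrite subv_add sDg diffvSl.
- by rewrite -{1}gE addvA [(C + D)%VS]addvC subvv.
apply: leq_ltn_trans (dimv_add_leqif D C) _.
have z0 : z != 0 by apply: contra Dz => /eqP->; rewrite mem0v.
have := dimv_cap_compl g (D + <[z]>); rewrite (capv_idPr sDz) -/C => <-.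
rewrite ltn_add2r dimv_disjoint_sum ?dim_vline ?z0 ?addn1 //.
apply/eqP; rewrite -subv0; apply/subvP => u; rewrite memv_cap.
case/andP=> Du /vlineP[a ua]; rewrite memv0 ua.
have [-> | a0] := eqVneq a 0; first by rewrite scale0r.
case/negP: Dz; rewrite -[z]scale1r -(mulVf a0) -scalerA -ua.
exact: memvZ.
Qed.

(** Stated for a representation rho, so that it applies to the action of a
    matrix Lie algebra on a subquotient of its natural module. *)
Lemma lie_theorem (F : numClosedFieldType) n d (rho : 'Hom('M[F]_n, 'M[F]_d))
    (g : {vspace 'M[F]_n}) (W : 'M[F]_d) :
  lie_subalgebra g -> lie_solvable g ->
  {in g &, forall x y, rho (lie_bracket x y) = lie_bracket (rho x) (rho y)} ->
  W != 0 -> {in g, forall x, stablemx W (rho x)} ->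
  exists v : 'rV[F]_d, [/\ v != 0, (v <= W)%MS &
    {in g, forall x, exists a, v *m rho x = a *: v}].
Proof.
have [m] := ubnP (\dim g); elim: m g => // m IHm g ltgm.
move=> lie_g sol_g rhoB W0 stW.
have [g0 | g0] := eqVneq g 0%VS.
  exists (nz_row W); split; rewrite ?nz_row_eq0 ?nz_row_sub // => x.
  rewrite g0 memv0 => /eqP->; exists 0.
  by rewrite linear0 mulmx0 scale0r.
have [k [z [sDk skg gz sgkz ltkg]]] := solvable_hyperplane lie_g sol_g g0.
have sub_kg := subvP skg.
have [||||||v [v0 vW vk]] := IHm k => //.
- exact: leq_trans ltkg _.
- move=> x y kx ky; apply: subvP sDk _ _.
  by apply: (lie_prod_subvP _ _ _ (subvv _)); apply: sub_kg.
- exact: lie_solvableS sol_g.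
- by move=> x y kx ky; rewrite rhoB //; apply: sub_kg.
- by move=> x kx; apply/stW/sub_kg.
pose K y := exists2 x, x \in k & y = rho x.
pose lam y := (v *m y *m pinvmx v) 0 0.
have bracketK y : K y -> K (lie_bracket y (rho z)).
  case=> x kx ->; exists (lie_bracket x z); last by rewrite rhoB //; apply: sub_kg.
  apply: subvP sDk _ _.
  by apply: (lie_prod_subvP _ _ _ (subvv _)) => //; apply: sub_kg.
have vlam y : K y -> v *m y = lam y *: v.
  case=> x /vk[a va] ->; rewrite /lam va -scalemxAl mulmxVp.
    by rewrite !mxE mulr1.
  by rewrite /row_free rank_rV v0.
have [U [vU stU Uk]] := weight_space_invariant bracketK vlam v0.
have UW0 : (U :&: W)%MS != 0.
  by apply: contra v0 => /eqP UW; rewrite -submx0 -UW sub_capmx vU.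
have stUW : stablemx (U :&: W)%MS (rho z).
  rewrite sub_capmx (submx_trans (submxMr _ (capmxSl _ _))) //=.
  by rewrite (submx_trans (submxMr _ (capmxSr _ _))) ?stW.
have [u [a [u0 uUW uz]]] := stable_eigenvector UW0 stUW.
move: uUW; rewrite sub_capmx => /andP[uU uW].
exists u; split=> // x /(subvP sgkz)/memv_addP[y ky [_ /vlineP[c ->] ->]].
exists (lam (rho y) + c * a).
rewrite linearD linearZ mulmxDr -scalemxAr uz (Uk (rho y)) //; last by exists y.
by rewrite scalerA scalerDl.
Qed.

(** * Invariant isotropic flags *)

Definition antidiag (F : fieldType) d : 'M[F]_d :=
  \matrix_(i, j) ((i + j).+1 == d)%N%:R.

Lemma antidiagE (F : fieldType) d (i j : 'I_d) :
  antidiag F d i j = (j == rev_ord i)%:R.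
Proof.
rewrite mxE -val_eqE /=; have := ltn_ord i; have := ltn_ord j.
by move=> *; congr (nat_of_bool _)%:R; lia.
Qed.

Lemma antidiag_involutive (F : fieldType) d :
  antidiag F d *m antidiag F d = 1%:M.
Proof.
apply/matrixP => i j; rewrite !mxE (bigD1 (rev_ord i)) //= big1 ?addr0.
  by rewrite !antidiagE rev_ordK eqxx mul1r eq_sym.
by move=> k /negPf ki; rewrite !antidiagE ki mul0r.
Qed.

Lemma antidiag_unit (F : fieldType) d : antidiag F d \in unitmx.
Proof. by case/mulmx1_unit: (antidiag_involutive F d). Qed.

(** Bordering by a hyperbolic plane: this is the shape of the Gram matrix in
    the inductive step of [skew_triangularization]. *)
Lemma antidiag_border (F : fieldType) m : antidiag F (1 + m + 1) =
  block_mx (block_mx 0 0 0 (antidiag F m)) (col_mx 1%:M 0) (row_mx 1%:M 0) 0.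
Proof.
apply/matrixP => i j; rewrite !mxE.
case: split_ordP => i1 ->; rewrite !mxE; case: split_ordP => j1 ->; rewrite ?mxE.
- case: split_ordP => i2 ->; rewrite !mxE; case: split_ordP => j2 ->;
    rewrite !mxE /= ?ord1 /=.
  + by case: eqP => //= ?; lia.
  + by have := ltn_ord j2; case: eqP => //= ?; lia.
  + by have := ltn_ord i2; case: eqP => //= ?; lia.
  + by congr (nat_of_bool _)%:R; lia.
- case: split_ordP => i2 ->; rewrite !mxE /= ?ord1 /=.
  + by case: eqP => //= ?; lia.
  + by case: eqP => //= ?; lia.
- case: split_ordP => j2 ->; rewrite !mxE /= ?ord1 /=.
  + by case: eqP => //= ?; lia.
  + by case: eqP => //= ?; lia.
- by case: eqP => //= ?; lia.
Qed.

Lemma hyperbolic_partner (F : numFieldType) d (S : 'M[F]_d) (v : 'rV_d) :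
  S^T = S -> S \in unitmx -> v != 0 -> v *m S *m v^T = 0 ->
  exists2 w : 'rV_d, w *m S *m w^T = 0 & w *m S *m v^T = 1%:M.
Proof.
move=> symS unitS v0 vv.
have symf (x y : 'rV_d) : x *m S *m y^T = y *m S *m x^T.
  by rewrite [LHS]mx11_scalar -tr_scalar_mx -mx11_scalar !trmx_mul trmxK symS mulmxA.
have vS0 : row_free (v *m S).
  by rewrite /row_free rank_rV mulmx_free_eq0 ?row_free_unit ?v0.
pose y := (pinvmx (v *m S))^T.
have vy : v *m S *m y^T = 1%:M by rewrite trmxK mulmxVp.
pose a := (y *m S *m y^T) 0 0.
have yy : y *m S *m y^T = a%:M by rewrite [LHS]mx11_scalar.
(* y pairs to 1 with v; subtracting half of <y, y> times v makes it isotropic *)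
exists (y - (a / 2) *: v); last first.
  by rewrite !mulmxBl -!scalemxAl vv scaler0 subr0 symf.
have -> : (y - (a / 2) *: v)^T = y^T - (a / 2) *: v^T.
  by apply/matrixP => i j; rewrite !mxE.
rewrite !mulmxBl !mulmxBr -!scalemxAr -!scalemxAl vv.
rewrite (symf y v) vy yy !scaler0 subr0 -addrA -opprD -scalerDl -splitr.
by rewrite scalemx1 subrr.
Qed.

(** The rows of C are taken in the kernel of x |-> (<x, w>, <x, v>), which
    has dimension at least m; nondegeneracy of the form on the hyperbolic
    plane makes w, C, v a basis. *)
Lemma hyperbolic_complement (F : fieldType) m (S : 'M[F]_(1 + m + 1))
    (v w : 'rV_(1 + m + 1)) :
  S^T = S -> S \in unitmx ->
  v *m S *m v^T = 0 -> w *m S *m w^T = 0 -> w *m S *m v^T = 1%:M ->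
  exists C : 'M_(m, 1 + m + 1), [/\ C *m S *m v^T = 0, C *m S *m w^T = 0,
    C *m S *m C^T \in unitmx & col_mx (col_mx w C) v \in unitmx].
Proof.
move=> symS unitS vv ww wv.
have vw : v *m S *m w^T = 1%:M.
  by have := congr1 trmx wv; rewrite !trmx_mul trmxK symS tr_scalar_mx mulmxA.
set B := row_mx (S *m w^T) (S *m v^T); set K := kermx B.
have rK : (m <= \rank K)%N.
  by rewrite mxrank_ker leq_subRL; have := rank_leq_col B; lia.
pose C : 'M_(m, 1 + m + 1) := pid_mx m *m row_base K.
have freeC : row_free C.
  by rewrite /row_free mxrankMfree ?row_base_free // rank_pid_mx.
have : (C <= K)%MS by rewrite (submx_trans (submxMl _ _)) // eq_row_base.
move/sub_kermxP; rewrite mul_mx_row !mulmxA => /eqP.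
rewrite row_mx_eq0 => /andP[/eqP Cw /eqP Cv].
move: C freeC Cw Cv => C freeC Cw Cv.
have freeQ : col_mx (col_mx w C) v \in unitmx.
  rewrite -row_free_unit -kermx_eq0; set k := kermx _.
  have := mulmx_ker (col_mx (col_mx w C) v); rewrite -/k.
  rewrite -[k]hsubmxK; move: (rsubmx k) (lsubmx k) => b ac.
  rewrite -[ac]hsubmxK; move: (rsubmx ac) (lsubmx ac) => c a.
  rewrite !mul_row_col => e.
  have pair (y : 'cV_(1 + m + 1)) :
      a *m (w *m S *m y) + c *m (C *m S *m y) + b *m (v *m S *m y) = 0.
    by rewrite !mulmxA -!mulmxDl e !mul0mx.
  have a0 : a = 0.
    by have := pair v^T; rewrite wv Cv vv !mulmx0 !addr0 mulmx1.
  have b0 : b = 0.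
    by have := pair w^T; rewrite ww Cw vw !mulmx0 !add0r mulmx1.
  move/eqP: e; rewrite a0 b0 !mul0mx add0r addr0 mulmx_free_eq0 // => /eqP->.
  by rewrite !row_mx0.
exists C; split=> //.
rewrite -row_free_unit -kermx_eq0.
have := mulmx_ker (C *m S *m C^T); move: (kermx _) => k kS.
have kC : k *m C *m (S *m (col_mx (col_mx w C) v)^T) = 0.
  have kCS p (y : 'M_(_, p)) : k *m C *m (S *m y) = k *m (C *m S *m y).
    by rewrite !mulmxA.
  by rewrite !tr_col_mx !mul_mx_row !kCS Cw Cv kS !mulmx0 !row_mx0.
have freeSQ : row_free (S *m (col_mx (col_mx w C) v)^T).
  by rewrite row_free_unit unitmx_mul unitS unitmx_tr.
by move/eqP: kC; rewrite (mulmx_free_eq0 _ freeSQ) (mulmx_free_eq0 _ freeC).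
Qed.

Section InvariantFlag.
Variables (F : numClosedFieldType) (n : nat) (g : {vspace 'M[F]_n}).
Hypothesis lie_g : lie_subalgebra g.
Hypothesis sol_g : lie_solvable g.

Definition skew_representation d (S : 'M[F]_d) (rho : 'Hom('M[F]_n, 'M[F]_d)) :=
  {in g &, forall x y, rho (lie_bracket x y) = lie_bracket (rho x) (rho y)} /\
  {in g, forall x, rho x *m S = - (S *m (rho x)^T)}.

(** If the first eigenvector v is not isotropic, its orthogonal space is
    invariant and contains another eigenvector w.  If w is not isotropic
    either, both are killed by the algebra, so any combination is a common
    eigenvector, and over an algebraically closed field v + c w is isotropic
    for a suitable c. *)
Lemma isotropic_eigenvector d (S : 'M[F]_d) (rho : 'Hom('M[F]_n, 'M[F]_d)) :
  (1 < d)%N -> S^T = S -> skew_representation S rho ->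
  exists v : 'rV[F]_d, [/\ v != 0, v *m S *m v^T = 0 &
    {in g, forall x, exists a, v *m rho x = a *: v}].
Proof.
move=> d_gt1 symS [rhoB skew].
have symf (u v : 'rV_d) : u *m S *m v^T = v *m S *m u^T.
  by rewrite [LHS]mx11_scalar -tr_scalar_mx -mx11_scalar !trmx_mul trmxK symS mulmxA.
have [|v [v0 _ vx]] := lie_theorem (W := 1%:M) lie_g sol_g rhoB _ (fun _ _ => submx1 _).
  by rewrite -mxrank_eq0 mxrank1 -lt0n ltnW.
have [vv | vv] := eqVneq (v *m S *m v^T) 0; first by exists v.
(* if u x = a u then a <u, u> = <u x, u> = - <u, u x> = - a <u, u> *)
have killed (u : 'rV_d) : u *m S *m u^T != 0 ->
    {in g, forall x, exists a, u *m rho x = a *: u} ->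
    {in g, forall x, u *m rho x = 0}.
  move=> uu ux x gx; have [a ua] := ux x gx.
  have : u *m rho x *m S *m u^T = - (u *m rho x *m S *m u^T).
    rewrite -[in LHS](mulmxA u) skew // mulmxN mulNmx; congr (- _).
    by rewrite [RHS]symf trmx_mul !mulmxA.
  rewrite ua -!scalemxAl => /eqP; rewrite -addr_eq0 -mulr2n -scaler_nat.
  rewrite !scalemx_eq0 pnatr_eq0 (negPf uu) orbF /= => /eqP->.
  by rewrite scale0r.
have Wv0 : kermx (S *m v^T) != 0.
  rewrite -mxrank_eq0 mxrank_ker subn_eq0 -ltnNge.
  exact: leq_ltn_trans (rank_leq_col _) d_gt1.
have [x gx | w [w0 wv wx]] := lie_theorem lie_g sol_g rhoB Wv0.
  apply/sub_kermxP; rewrite mulmxA -(mulmxA _ _ S) skew // mulmxN mulNmx.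
  rewrite -!mulmxA -trmx_mul (killed v vv vx) // trmx0 !mulmx0 oppr0 //.
have {}wv : w *m S *m v^T = 0 by move/sub_kermxP: wv; rewrite mulmxA.
have [ww | ww] := eqVneq (w *m S *m w^T) 0; first by exists w.
pose a := (v *m S *m v^T) 0 0; pose b := (w *m S *m w^T) 0 0.
have b0 : b != 0.
  apply: contra ww; rewrite /b => /eqP b0; apply/eqP/matrixP => i j.
  by rewrite !ord1 b0 mxE.
pose c := sqrtC (- a / b).
exists (v + c *: w); split.
- apply: contra vv => /eqP vcw; have vE : v = - c *: w.
    by apply/eqP; rewrite scaleNr -addr_eq0 vcw.
  by rewrite {1}vE -!scalemxAl wv scaler0.
- have vwS : v *m S *m w^T = 0 by rewrite symf.
  rewrite linearD linearZ /= !mulmxDl !mulmxDr -!scalemxAr -!scalemxAl wv vwS.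
  rewrite !scaler0 add0r addr0 scalerA -expr2 sqrtCK.
  apply/matrixP => i j; rewrite !ord1 mxE [X in _ + X]mxE [RHS]mxE -/a -/b.
  by rewrite mulfVK // subrr.
- move=> x gx; exists 0; rewrite scale0r mulmxDl -scalemxAl.
  by rewrite (killed v) // (killed w) // scaler0 addr0.
Qed.

(** In the basis w, C, v of [hyperbolic_complement], where v is an isotropic
    eigenvector, skewness makes the span of C and v invariant, so that x acts
    by a block upper triangular matrix; the middle block rho' is a skew
    representation on a smaller space. *)
Lemma skew_triangularization r d (S : 'M[F]_d)
    (rho : 'Hom('M[F]_n, 'M[F]_d)) :
  d = (2 * r).+1 -> S^T = S -> S \in unitmx -> skew_representation S rho ->
  exists2 P : 'M[F]_d, P *m S *m P^T = antidiag F d &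
    {in g, forall x, exists2 T : 'M[F]_d, is_trig_mx T^T & P *m rho x = T *m P}.
Proof.
elim: r d S rho => [|r IHr] d S rho.
  move=> d1; move: S rho; rewrite d1 => S rho symS unitS _.
  have a0 : S 0 0 != 0 by move: unitS; rewrite unitmxE det_mx11 unitfE.
  pose c := (sqrtC (S 0 0))^-1; exists c%:M.
    apply/matrixP => i j; rewrite !ord1 tr_scalar_mx mul_scalar_mx mul_mx_scalar.
    by rewrite !mxE /= /c mulrCA mulrA -expr2 exprVn sqrtCK mulVf.
  move=> x gx; exists (rho x); first exact: mx11_is_trig.
  by rewrite scalar_mxC.
set m := (2 * r).+1 => dE; have {}dE : d = (1 + m + 1)%N by rewrite dE /m; lia.
subst d => symS unitS rhoS; have [rhoB skew] := rhoS.
have [|v [v0 vv vx]] := isotropic_eigenvector _ symS rhoS; first by lia.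
have [w ww wv] := hyperbolic_partner symS unitS v0 vv.
have [C [Cv Cw unitS' unitQ]] := hyperbolic_complement symS unitS vv ww wv.
have symf p q (x : 'M_(p, _)) (y : 'M_(q, _)) : (x *m S *m y^T)^T = y *m S *m x^T.
  by rewrite !trmx_mul trmxK symS mulmxA.
have vw : v *m S *m w^T = 1%:M by rewrite -symf wv tr_scalar_mx.
have vC : v *m S *m C^T = 0 by rewrite -symf Cv trmx0.
have wC : w *m S *m C^T = 0 by rewrite -symf Cw trmx0.
set S' := C *m S *m C^T in unitS'; have symS' : S'^T = S' by rewrite symf.
have [Z CZ vZ] : exists2 Z, C *m Z = 1%:M & v *m Z = 0.
  exists (S *m C^T *m invmx S'); first by rewrite !mulmxA mulmxV.
  by rewrite !mulmxA vC mul0mx.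
pose rho' : 'Hom('M[F]_n, 'M[F]_m) :=
  (linfun (mulmxr Z) \o (linfun (mulmx C) \o rho))%VF.
have rho'E x : rho' x = C *m rho x *m Z by rewrite !comp_lfunE !lfunE.
(* the w-coordinate of C x is C x S v^T = - C S (v x)^T, which is
   a multiple of C S v^T = 0 *)
have Cx x : x \in g -> exists b, C *m rho x = rho' x *m C + b *m v.
  move=> gx; pose t := C *m rho x *m invmx (col_mx (col_mx w C) v).
  have : C *m rho x = t *m col_mx (col_mx w C) v by rewrite mulmxKV.
  rewrite -[t]hsubmxK; move: (rsubmx t) (lsubmx t) => b ac.
  rewrite -[ac]hsubmxK; move: (rsubmx ac) (lsubmx ac) => c a.
  rewrite !mul_row_col => e.
  have a0 : a = 0.
    have [c' vc] := vx x gx.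
    have : C *m rho x *m S *m v^T = 0.
      rewrite -(mulmxA C) skew // mulmxN mulNmx mulmxA -mulmxA -trmx_mul vc.
      by rewrite linearZ -scalemxAr Cv scaler0 oppr0.
    rewrite e !mulmxDl -!mulmxA !(mulmxA w) !(mulmxA C) !(mulmxA v).
    by rewrite wv Cv vv !mulmx0 !addr0 mulmx1.
  exists b; rewrite e a0 mul0mx add0r; congr (_ *m _ + _).
  by rewrite rho'E e a0 mul0mx add0r mulmxDl -!mulmxA CZ vZ mulmx0 addr0 mulmx1.
have rhoS' : skew_representation S' rho'.
  split=> [x y gx gy | x gx].
    have Cxy x1 y1 : x1 \in g -> y1 \in g ->
        C *m (rho x1 *m rho y1) *m Z = rho' x1 *m rho' y1.
      move=> gx1 gy1; have [b1 e1] := Cx x1 gx1; have [b2 e2] := Cx y1 gy1.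
      have [a va] := vx y1 gy1.
      rewrite mulmxA e1 mulmxDl -[_ *m C *m _]mulmxA e2 -[_ *m v *m _]mulmxA va.
      rewrite mulmxDr !mulmxDl -!mulmxA -scalemxAl CZ vZ mulmx1 scaler0.
      by rewrite !mulmx0 !addr0.
    rewrite rho'E rhoB // lie_bracketE mulmxBr mulmxBl !Cxy //.
  have e : rho' x *m S' = C *m rho x *m S *m C^T.
    have [b e] := Cx x gx.
    by rewrite e !mulmxDl -!(mulmxA b) vC mulmx0 addr0 /S' !mulmxA.
  rewrite e -[S' in RHS]symS' -trmx_mul e !trmx_mul trmxK symS !mulmxA.
  by rewrite -[in LHS](mulmxA C) skew // mulmxN mulNmx !mulmxA.
have [P' P'S trigP'] := IHr m S' rho' erefl symS' unitS' rhoS'.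
have unitP' : P' \in unitmx.
  have := antidiag_unit F m; rewrite -P'S -mulmxA unitmx_mul.
  by case/andP.
exists (col_mx (col_mx w (P' *m C)) v).
  rewrite antidiag_border !tr_col_mx !mul_col_mx !mul_mx_row trmx_mul.
  rewrite -P'S /S' block_mxEv !mulmxA ww vv wv vw wC vC.
  have P'e p (y : 'M_(_, p)) : P' *m C *m S *m y = P' *m (C *m S *m y).
    by rewrite !mulmxA.
  rewrite !P'e Cw Cv !mulmx0 !mul0mx; congr (col_mx _ _).
  by rewrite -block_mxEv block_mxEh.
move=> x gx; have [T' trigT' P'x] := trigP' x gx.
have [b Cb] := Cx x gx; have [a va] := vx x gx.
pose t := w *m rho x *m invmx (col_mx (col_mx w C) v).
have : w *m rho x = t *m col_mx (col_mx w C) v by rewrite mulmxKV.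
rewrite -[t]hsubmxK; move: (rsubmx t) (lsubmx t) => t3 t12.
rewrite -[t12]hsubmxK; move: (rsubmx t12) (lsubmx t12) => t2 t1.
rewrite !mul_row_col => wt.
exists (block_mx (block_mx t1 (t2 *m invmx P') 0 T')
                 (col_mx t3 (P' *m b)) 0 a%:M).
  rewrite !tr_block_mx !is_trig_block_mx // !trmx0 !eqxx trigT' /=.
  by rewrite !mx11_is_trig.
rewrite !mul_block_col !mul_col_mx !mul0mx !add0r wt va.
rewrite -mulmxA Cb mulmxDr !mulmxA P'x mulmxKV // add_col_mx.
by rewrite mul_scalar_mx.
Qed.
End InvariantFlag.

(** * Conjugating a Borel subalgebra into triangular form *)

Section SupportSpaces.
Variables (F : fieldType) (d : nat).
Implicit Types (x y : 'M[F]_d) (A B : rel 'I_d).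

Definition off_support A y : 'M[F]_d :=
  \matrix_(i, j) (if A i j then 0 else y i j).

Fact off_support_linear A : linear (off_support A).
Proof.
move=> a x y; apply/matrixP => i j; rewrite !mxE.
by case: ifP => // _; rewrite mulr0 addr0.
Qed.

HB.instance Definition _ A :=
  GRing.isLinear.Build F 'M[F]_d 'M[F]_d _ (off_support A) (off_support_linear A).

Definition support_space A : {vspace 'M[F]_d} := lker (linfun (off_support A)).

Lemma support_spaceP A y :
  reflect (forall i j, y i j != 0 -> A i j) (y \in support_space A).
Proof.
rewrite memv_ker lfunE /=; apply: (iffP eqP) => [/matrixP y0 i j | yA].
  by apply: contraR => /negPf Aij; have := y0 i j; rewrite !mxE Aij => ->.
apply/matrixP => i j; rewrite !mxE; case: ifPn => // Aij.
by apply: contraNeq Aij => /yA.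
Qed.

Definition flipmx y : 'M[F]_d := \matrix_(i, j) y (rev_ord j) (rev_ord i).

Definition skewing y : 'M[F]_d := y + flipmx y.

Fact skewing_linear : linear skewing.
Proof. by move=> a x y; apply/matrixP => i j; rewrite !mxE; ring. Qed.

HB.instance Definition _ :=
  GRing.isLinear.Build F 'M[F]_d 'M[F]_d _ skewing skewing_linear.

(** The orthogonal Lie algebra of the antidiagonal form; see [skew_spaceE]. *)
Definition skew_space : {vspace 'M[F]_d} := lker (linfun skewing).

Lemma skew_spaceP y :
  reflect (forall i j, y (rev_ord j) (rev_ord i) = - y i j) (y \in skew_space).
Proof.
rewrite memv_ker lfunE /=; apply: (iffP eqP) => [/matrixP y0 i j | yA].
  by apply/eqP; rewrite eq_sym eqr_oppLR -addr_eq0; have := y0 i j; rewrite !mxE => ->.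
by apply/matrixP => i j; rewrite !mxE yA subrr.
Qed.

Lemma skew_spaceE y :
  (y \in skew_space) = (y *m antidiag F d == - (antidiag F d *m y^T)).
Proof.
have yJ i j : (y *m antidiag F d) i j = y i (rev_ord j).
  rewrite mxE (bigD1 (rev_ord j)) //= big1 ?addr0.
    by rewrite antidiagE rev_ordK eqxx mulr1.
  move=> k kj; rewrite antidiagE; case: eqP => [jk|]; last by rewrite mulr0.
  by case/eqP: kj; rewrite jk rev_ordK.
have Jy i j : (antidiag F d *m y^T) i j = y j (rev_ord i).
  rewrite mxE (bigD1 (rev_ord i)) //= big1 ?addr0.
    by rewrite antidiagE eqxx mul1r mxE.
  by move=> k /negPf ki; rewrite antidiagE ki mul0r.
apply/skew_spaceP/eqP => [sk | /matrixP e i j].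
  apply/matrixP => i j; rewrite yJ mxE Jy.
  by rewrite -[j in RHS]rev_ordK sk opprK.
have := e (rev_ord j) i; rewrite yJ mxE Jy rev_ordK //.
Qed.

End SupportSpaces.

Section LieImages.
Variables (F : fieldType) (d : nat).
Implicit Types (x y P : 'M[F]_d) (U V I b : {vspace 'M[F]_d}).

Lemma skew_space_bracket : lie_subalgebra (skew_space F d).
Proof.
move=> x y; rewrite !skew_spaceE => /eqP xJ /eqP yJ.
rewrite /lie_bracket mulmxBl -!mulmxA xJ yJ !mulmxN !mulmxA xJ yJ !mulNmx.
by rewrite linearB /= !trmx_mul mulmxBr !mulmxA opprB !opprK.
Qed.

Definition upper k : rel 'I_d := fun i j => (i + k <= j)%N.

Lemma upper_bracket k l x y :
  x \in support_space F (upper k) -> y \in support_space F (upper l) ->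
  lie_bracket x y \in support_space F (upper (k + l)).
Proof.
move=> /support_spaceP xk /support_spaceP yl.
suff xy (u v : 'M_d) k' l' : (forall i j, u i j != 0 -> upper k' i j) ->
    (forall i j, v i j != 0 -> upper l' i j) ->
    u *m v \in support_space F (upper (k' + l')).
  by apply: rpredB; [exact: xy | rewrite addnC; exact: xy].
move=> uk vl; apply/support_spaceP => i j; apply: contraR => ij.
rewrite mxE big1 // => h _; apply/eqP; apply: contraR ij.
rewrite mulf_eq0 negb_or => /andP[/uk ih /vl hj].
by rewrite /upper in ih hj *; lia.
Qed.

Lemma upper_bracket0 x y :
  x \in support_space F (upper 0) -> y \in support_space F (upper 0) ->
  lie_bracket x y \in support_space F (upper 1).
Proof.
move=> xk yl; have /support_spaceP xy := upper_bracket xk yl.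
apply/support_spaceP => i j ij; have {xy} := xy i j ij; rewrite /upper.
suff : i != j by rewrite -val_eqE /=; lia.
apply: contraNneq ij => <-.
have diag (u v : 'M_d) : u \in support_space F (upper 0) ->
    v \in support_space F (upper 0) -> (u *m v) i i = u i i * v i i.
  move=> /support_spaceP uk /support_spaceP vl.
  rewrite mxE (bigD1 i) //= big1 ?addr0 // => h; apply: contraNeq.
  rewrite mulf_eq0 negb_or => /andP[/uk ih /vl hi].
  by apply/eqP/ord_inj; rewrite /upper in ih hi; lia.
by rewrite mxE [X in _ + X]mxE !diag // mulrC subrr.
Qed.

(** The first bracket kills the diagonal, and afterwards each derived algebra
    lies at least one diagonal further from the main one. *)
Lemma upper_solvable : lie_solvable (support_space F (upper 0)).
Proof.
have D k : (derived_series k.+1 (support_space F (upper 0))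
            <= support_space F (upper k.+1))%VS.
  elim: k => [|k IHk]; apply/lie_prod_subvP => x y xD yD.
    exact: upper_bracket0.
  move/subvP: IHk => IHk.
  have /support_spaceP xy := upper_bracket (IHk _ xD) (IHk _ yD).
  by apply/support_spaceP => i j /xy; rewrite /upper; lia.
exists d.+1; apply/eqP; rewrite -subv0; apply: subv_trans (D d) _.
apply/subvP => x /support_spaceP x0; rewrite memv0; apply/eqP/matrixP => i j.
rewrite mxE; apply/eqP; apply: contraT => /x0.
by rewrite /upper; have := ltn_ord j; lia.
Qed.

Definition conj_by P : 'End('M[F]_d) :=
  (linfun (mulmxr (invmx P)) \o linfun (mulmx P))%VF.

Lemma conjE P x : conj_by P x = P *m x *m invmx P.
Proof. by rewrite comp_lfunE !lfunE. Qed.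

Lemma conjK P : P \in unitmx -> cancel (conj_by P) (conj_by (invmx P)).
Proof.
by move=> uP x; rewrite !conjE invmxK !mulmxA mulVmx // mul1mx mulmxKV.
Qed.

Lemma conjVK P : P \in unitmx -> cancel (conj_by (invmx P)) (conj_by P).
Proof. by move=> uP x; rewrite -[in conj_by P](invmxK P) conjK ?unitmx_inv. Qed.

Lemma mem_conj P U x : P \in unitmx ->
  (x \in (conj_by P @: U)%VS) = (conj_by (invmx P) x \in U).
Proof.
move=> uP; apply/idP/idP => [/memv_imgP[y Uy ->] | Ux]; first by rewrite conjK.
by rewrite -[x](conjVK uP) memv_img.
Qed.

Lemma conj_bracket P x y : P \in unitmx ->
  conj_by P (lie_bracket x y) = lie_bracket (conj_by P x) (conj_by P y).
Proof.
by move=> uP; rewrite !conjE /lie_bracket mulmxBr mulmxBl !mulmxA !mulmxKV.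
Qed.

Lemma conjVK_img P U : P \in unitmx -> (conj_by P @: (conj_by (invmx P) @: U))%VS = U.
Proof.
by move=> uP; apply/vspaceP => x; rewrite !mem_conj ?unitmx_inv // invmxK conjVK.
Qed.

Lemma conjK_img P U : P \in unitmx -> (conj_by (invmx P) @: (conj_by P @: U))%VS = U.
Proof.
move=> uP; have uV : invmx P \in unitmx by rewrite unitmx_inv.
by have := conjVK_img U uV; rewrite invmxK.
Qed.

Lemma dim_conj P U : P \in unitmx -> \dim (conj_by P @: U) = \dim U.
Proof.
move=> uP; apply: limg_dim_eq; apply/eqP; rewrite -subv0; apply/subvP => x.
rewrite memv_cap memv_ker memv0 => /andP[_ /eqP x0].
by rewrite -[x](conjK uP) x0 linear0.
Qed.

Lemma conj_subalgebra P U :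
  P \in unitmx -> lie_subalgebra U -> lie_subalgebra (conj_by P @: U)%VS.
Proof.
move=> uP lieU x y; rewrite !mem_conj // => Ux Uy.
by rewrite conj_bracket ?unitmx_inv // lieU.
Qed.

Lemma conj_solvable P U :
  P \in unitmx -> lie_solvable U -> lie_solvable (conj_by P @: U)%VS.
Proof.
move=> uP [k Uk]; exists k; apply/eqP; rewrite -subv0.
suff : (derived_series k (conj_by P @: U) <= conj_by P @: derived_series k U)%VS.
  by rewrite Uk limg0.
elim: k {Uk} => //= k IHk; apply: subv_trans (lie_prodS IHk IHk) _.
apply/lie_prod_subvP => x y; rewrite !mem_conj // => xD yD.
rewrite conj_bracket ?unitmx_inv //.
exact: (lie_prod_subvP _ _ _ (subvv _)).
Qed.

Lemma conj_abelian_ideal P b I : P \in unitmx ->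
  abelian_ideal b I -> abelian_ideal (conj_by P @: b) (conj_by P @: I).
Proof.
move=> uP [[sIb idI] abI]; split; first split.
- exact: limgS.
- by move=> x y; rewrite !mem_conj // conj_bracket ?unitmx_inv //; apply: idI.
move=> x y; rewrite !mem_conj // => Ix Iy.
by rewrite -[LHS](conjVK uP) conj_bracket ?unitmx_inv // abI // linear0.
Qed.

End LieImages.

Definition std_borel (F : fieldType) d : {vspace 'M[F]_d} :=
  (skew_space F d :&: support_space F (upper (d := d) 0))%VS.

Lemma std_borel_subalgebra (F : fieldType) d : lie_subalgebra (std_borel F d).
Proof.
move=> x y /memv_capP[xs xu] /memv_capP[ys yu].
by rewrite memv_cap skew_space_bracket // -[0%N]addn0 upper_bracket.
Qed.

Lemma std_borel_solvable (F : fieldType) d : lie_solvable (std_borel F d).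
Proof. exact: lie_solvableS (capvSr _ _) (upper_solvable _ _). Qed.

Lemma orthogonal_conj (F : fieldType) d (P x : 'M[F]_d) :
  P *m P^T = antidiag F d ->
  (conj_by P x \in skew_space F d) = (x \in orthogonal_lie F d).
Proof.
move=> PP; have uP : P \in unitmx.
  by have := antidiag_unit F d; rewrite -PP unitmx_mul => /andP[].
rewrite skew_spaceE mem_orthogonal_lie conjE -PP !trmx_mul !mulmxA mulmxKV //.
rewrite -[P *m P^T *m _]mulmxA -trmx_mul mulVmx // trmx1 mulmx1.
have uPT : P^T \in unitmx by rewrite unitmx_tr.
apply/eqP/eqP => [e | ->]; last by rewrite mulmxN mulNmx opprK.
apply: (can_inj (mulKmx uP)); apply: (can_inj (mulmxK uPT)).
by rewrite mulmxN mulNmx e opprK.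
Qed.

(** Conjugation by the basis change of [skew_triangularization] maps b into
    the triangular algebra; the inverse image of the latter is solvable and
    contains b, so it equals b by maximality. *)
Lemma borel_conj (F : numClosedFieldType) r (b : {vspace 'M[F]_((2 * r).+1)}) :
  borel_subalgebra (orthogonal_lie F (2 * r).+1) b ->
  exists2 P, P \in unitmx & (conj_by P @: b)%VS = std_borel F (2 * r).+1.
Proof.
case=> sb lie_b sol_b maxb; set d := (2 * r).+1.
have skew_id : skew_representation b 1%:M (\1%VF : 'Hom('M[F]_d, 'M[F]_d)).
  split=> [x y _ _ | x bx]; first by rewrite !lfunE.
  rewrite !lfunE mulmx1 mul1mx /=; have := subvP sb _ bx.
  by rewrite mem_orthogonal_lie => /eqP->; rewrite opprK.
have [P PP trigP] :=
  skew_triangularization lie_b sol_b (erefl d) (trmx1 F d) (unitmx1 F d) skew_id.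
rewrite mulmx1 in PP; have uP : P \in unitmx.
  by have := antidiag_unit F d; rewrite -PP unitmx_mul => /andP[].
exists P => //.
have sub_b : (conj_by P @: b <= std_borel F d)%VS.
  apply/subvP => x /memv_imgP[y by_ ->]; rewrite memv_cap orthogonal_conj //.
  rewrite (subvP sb) //=; have [T /is_trig_mxP T0] := trigP y by_.
  rewrite conjE lfunE /= => ->; rewrite mulmxK //.
  apply/support_spaceP => i j; rewrite /upper addn0 leqNgt.
  by apply: contra => ji; have := T0 _ _ ji; rewrite mxE => ->.
have uV : invmx P \in unitmx by rewrite unitmx_inv.
suff cb : (conj_by (invmx P) @: std_borel F d)%VS = b by rewrite -cb conjVK_img.
apply: maxb.
- apply/subvP => x; rewrite mem_conj // invmxK memv_cap => /andP[].
  by rewrite orthogonal_conj.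
- exact: conj_subalgebra uV (@std_borel_subalgebra _ _).
- exact: conj_solvable uV (std_borel_solvable _ _).
apply/subvP => x bx; rewrite mem_conj // invmxK.
by apply: (subvP sub_b); apply: memv_img.
Qed.

(** * Root vectors in ideals of the triangular Borel subalgebra *)

Section RootVectors.
Variables (F : numFieldType) (d : nat).
Implicit Types (i j k l : 'I_d) (x y : 'M[F]_d).

Definition rootmx i j : 'M[F]_d :=
  delta_mx i j - delta_mx (rev_ord j) (rev_ord i).

Lemma rootmxE i j k l : rootmx i j k l =
  ((k == i) && (l == j))%:R - ((k == rev_ord j) && (l == rev_ord i))%:R.
Proof. by rewrite !mxE. Qed.

Lemma rootmx_bracket i j k l :
  lie_bracket (rootmx i j) (rootmx k l) =
    rootmx i l *+ (j == k) - rootmx k j *+ (i == l)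
    - rootmx i (rev_ord k) *+ (j == rev_ord l)
    + rootmx (rev_ord l) j *+ (i == rev_ord k).
Proof.
rewrite /lie_bracket /rootmx !mulmxBl !mulmxBr !mul_delta_mx_cond !rev_ordK.
rewrite !(inj_eq rev_ord_inj) ![rev_ord _ == _](can2_eq rev_ordK rev_ordK).
rewrite (eq_sym k j) (eq_sym l i) (eq_sym l (rev_ord j)) (eq_sym k (rev_ord i)).
rewrite ![rev_ord _ == _](can2_eq rev_ordK rev_ordK).
do 4!case: (_ == _); rewrite ?mulr0n ?mulr1n;
  by apply/matrixP => a b; rewrite !mxE; ring.
Qed.

Lemma rootmx_skew i j : rootmx i j \in skew_space F d.
Proof.
apply/skew_spaceP => k l; rewrite !rootmxE opprB.
rewrite !(inj_eq rev_ord_inj) ![rev_ord _ == _](can2_eq rev_ordK rev_ordK).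
by congr (_%:R - _%:R); rewrite andbC.
Qed.

Lemma skew_antidiag0 x i j : x \in skew_space F d -> ((i + j).+1 = d)%N ->
  x i j = 0.
Proof.
move=> /skew_spaceP sk e; have := sk i j.
have -> : rev_ord j = i by apply: val_inj => /=; lia.
have -> : rev_ord i = j by apply: val_inj => /=; lia.
by move/eqP; rewrite -addr_eq0 -mulr2n -mulr_natr mulf_eq0 pnatr_eq0 orbF => /eqP.
Qed.

(** A skew matrix vanishes on the antidiagonal and is determined by the
    entries above it, so it is the combination of the root vectors of these
    positions with its own entries as coefficients. *)
Lemma skew_mem x (W : {vspace 'M[F]_d}) : x \in skew_space F d ->
  (forall i j, ((i + j).+1 < d)%N -> x i j != 0 -> rootmx i j \in W) -> x \in W.
Proof.
move=> sk xW.
suff -> : x = \sum_(ij : 'I_d * 'I_d | ((ij.1 + ij.2).+1 < d)%N)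
    x ij.1 ij.2 *: rootmx ij.1 ij.2.
  apply: rpred_sum => -[i j] /= ij; have [->|nz] := eqVneq (x i j) 0.
    by rewrite scale0r rpred0.
  by rewrite rpredZ ?xW.
apply/matrixP => a b; rewrite summxE.
have term i j : (x i j *: rootmx i j) a b =
  x i j * (((a == i) && (b == j))%:R - ((a == rev_ord j) && (b == rev_ord i))%:R).
  by rewrite mxE rootmxE.
case: (ltngtP (a + b).+1 d) => ab.
- rewrite (bigD1 (a, b)) //= big1 ?addr0 => [|[i j] /= /andP[ij ne]].
    rewrite term !eqxx [X in _ - (nat_of_bool X)%:R](_ : _ = false) ?subr0 ?mulr1 //.
    by apply/negbTE/andP => -[/eqP/(congr1 val)/= e _]; lia.
  rewrite term (_ : _ && _ = false); last first.
    by apply: contraNF ne; rewrite xpair_eqE ![_ == i]eq_sym ![_ == j]eq_sym.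
  rewrite [X in _ - (nat_of_bool X)%:R](_ : _ = false) ?subrr ?mulr0 //.
  by apply/negbTE/andP => -[/eqP ea /eqP eb]; move: ab; rewrite ea eb /=; lia.
- rewrite (bigD1 (rev_ord b, rev_ord a)) /=; last first.
    by have := ltn_ord a; have := ltn_ord b; lia.
  rewrite big1 ?addr0 => [|[i j] /= /andP[ij ne]].
    rewrite term !rev_ordK !eqxx /= (_ : _ && _ = false) ?sub0r ?mulrN1.
      by move/skew_spaceP: sk => ->; rewrite opprK.
    apply/negbTE/andP => -[/eqP/(congr1 val)/= ea _].
    by have := ltn_ord a; have := ltn_ord b; lia.
  rewrite term (_ : _ && _ = false); last first.
    by apply/negbTE/andP => -[/eqP ea /eqP eb]; move: ab; rewrite ea eb /=; lia.
  rewrite [X in _ - (nat_of_bool X)%:R](_ : _ = false) ?subrr ?mulr0 //.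
  apply: contraNF ne => /andP[/eqP-> /eqP->].
  by rewrite !rev_ordK.
rewrite (skew_antidiag0 sk ab) big1 // => -[i j] /= ij; rewrite term.
rewrite (_ : _ && _ = false); last first.
  by apply/negbTE/andP => -[/eqP ea /eqP eb]; move: ab; rewrite ea eb /=; lia.
rewrite [X in _ - (nat_of_bool X)%:R](_ : _ = false) ?subrr ?mulr0 //.
apply/negbTE/andP => -[/eqP ea /eqP eb]; move: ab; rewrite ea eb /=.
by have := ltn_ord i; have := ltn_ord j; lia.
Qed.

End RootVectors.

Section TorusProjection.
Variables (F : numFieldType) (d : nat) (I : {vspace 'M[F]_d}).
Hypothesis idI : lie_ideal (std_borel F d) I.

Lemma diag_bracketE (h : 'I_d -> F) (x : 'M[F]_d) i j :
  lie_bracket (diag_mx (\row_a h a)) x i j = (h i - h j) * x i j.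
Proof.
by rewrite /lie_bracket mul_diag_mx mul_mx_diag !mxE; ring.
Qed.

Lemma diag_borel (h : 'I_d -> F) : (forall i, h (rev_ord i) = - h i) ->
  diag_mx (\row_a h a) \in std_borel F d.
Proof.
move=> oddh; rewrite memv_cap; apply/andP; split.
  apply/skew_spaceP => i j; rewrite !mxE (inj_eq rev_ord_inj) oddh (eq_sym j).
  by case: (eqVneq i j) => [->|_]; rewrite ?mulr0n ?oppr0.
apply/support_spaceP => i j; rewrite !mxE /upper.
by case: (eqVneq i j) => [->|_]; rewrite ?mulr0n ?eqxx // addn0.
Qed.

Lemma ideal_weight_poly (h : 'I_d -> F) (p : {poly F}) x :
  (forall i, h (rev_ord i) = - h i) -> x \in I ->
  \matrix_(i, j) (p.[h i - h j] * x i j) \in I.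
Proof.
move=> oddh Ix; elim/poly_ind: p => [|p c IHp].
  rewrite (_ : \matrix_(i, j) _ = 0) ?mem0v //.
  by apply/matrixP => i j; rewrite !mxE horner0 mul0r.
rewrite (_ : \matrix_(i, j) _ =
    lie_bracket (diag_mx (\row_a h a)) (\matrix_(i, j) (p.[h i - h j] * x i j))
    + c *: x).
  rewrite rpredD ?rpredZ //; apply: (proj2 idI) => //; exact: diag_borel.
apply/matrixP => i j; rewrite mxE [RHS]mxE diag_bracketE !mxE !hornerE /=; ring.
Qed.

(** The weight spaces of a diagonal matrix are cut out by polynomials in its
    adjoint action, here by Lagrange interpolation at the weight c. *)
Lemma ideal_weight_component (h : 'I_d -> F) (c : F) x :
  (forall i, h (rev_ord i) = - h i) -> x \in I ->
  \matrix_(i, j) (if h i - h j == c then x i j else 0) \in I.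
Proof.
move=> oddh Ix; pose w (ij : 'I_d * 'I_d) := h ij.1 - h ij.2.
pose p := \prod_(ij | w ij != c) ((c - w ij)^-1 *: ('X - (w ij)%:P)).
have := ideal_weight_poly p oddh Ix; congr (_ \in I).
apply/matrixP => i j; rewrite !mxE horner_prod; case: eqP => [->|/eqP ij].
  rewrite big1 ?mul1r // => kl wkl.
  by rewrite !hornerE mulVf // subr_eq0 eq_sym.
by rewrite (bigD1 (i, j)) //= !hornerE /w /= subrr mulr0 !mul0r.
Qed.

End TorusProjection.

Section AbelianIdeals.
Variables (F : numFieldType) (r : nat).
Notation d := (2 * r).+1.
Variable (I : {vspace 'M[F]_d}).
Hypothesis abI : abelian_ideal (std_borel F d) I.

Let idI : lie_ideal (std_borel F d) I. Proof. by case: abI. Qed.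

(** For the diagonal matrix with entries r - i, the weight of a position
    (i, j) is j - i, so weight 0 isolates the diagonal D of x, which therefore
    lies in I.  With e the root vector of the position (k, r), both D and
    [e, D] lie in I, and [D, [e, D]] has the entry - x_kk^2 there. *)
Lemma abelian_ideal_diag0 x i : x \in I -> x i i = 0.
Proof.
move=> Ix; have [sIb idl] := idI; have := subvP sIb _ Ix.
rewrite memv_cap => /andP[sk _].
have oddh (k : 'I_d) : (r%:R - (rev_ord k)%:R : F) = - (r%:R - k%:R).
  have -> : nat_of_ord (rev_ord k) = (2 * r - k)%N by rewrite /= subSS.
  by rewrite natrB -1?ltnS // natrM; ring.
have ID := ideal_weight_component idI 0 oddh Ix.
pose mid : 'I_d := inord r.
have midE : mid = r :> nat by rewrite inordK // ltnS; lia.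
have xmid : x mid mid = 0.
  by apply: skew_antidiag0 sk _; rewrite midE; lia.
set D := (X in X \in I) in ID.
have DE : D = diag_mx (\row_k x k k).
  apply/matrixP => k l; rewrite !mxE.
  have -> : (r%:R - k%:R) - (r%:R - l%:R) = l%:R - k%:R :> F by ring.
  by rewrite subr_eq0 eqr_nat eq_sym; case: (eqVneq k l) => [->|] /=;
    rewrite ?eqxx // => /negPf kl; rewrite val_eqE kl.
have xlow (k : 'I_d) : (k < r)%N -> x k k = 0.
  move=> kr; pose e := rootmx F k mid.
  have Ie : lie_bracket e D \in I.
    apply: idl => //; rewrite memv_cap rootmx_skew; apply/support_spaceP.
    move=> a b; rewrite rootmxE /upper addn0; apply: contraR; rewrite -ltnNge => ba.
    have -> : (a == k) && (b == mid) = false.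
      by apply/negbTE/andP => -[/eqP ea /eqP eb]; move: ba; rewrite ea eb midE; lia.
    have -> : (a == rev_ord mid) && (b == rev_ord k) = false.
      apply/negbTE/andP => -[/eqP ea /eqP eb]; move: ba.
      by rewrite ea eb /= midE; lia.
    by rewrite subrr.
  have := abI.2 _ _ ID Ie; move/matrixP/(_ k mid).
  have ekm : e k mid = 1.
    rewrite rootmxE !eqxx (_ : (k == rev_ord mid) && _ = false) ?subr0 //.
    by apply/negbTE/andP => -[/eqP/(congr1 val)/= e1 _]; rewrite midE in e1; lia.
  have -> : lie_bracket e D = - lie_bracket D e by rewrite /lie_bracket opprB.
  rewrite DE diag_bracketE mxE diag_bracketE ekm xmid subr0 mulr1 mxE.
  by move/eqP; rewrite mulrN oppr_eq0 mulf_eq0 orbb => /eqP.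
case: (ltngtP i r) => ir; first exact: xlow.
  have := xlow (rev_ord i); move/skew_spaceP: sk => ->.
  by move=> x0; apply/eqP; rewrite -oppr_eq0 x0 //=; have := ltn_ord i; lia.
by have -> : i = mid by apply: val_inj; rewrite /= midE.
Qed.

End AbelianIdeals.

(** An odd weight for which the position (i, j) can be recovered, up to the
    reflection in the antidiagonal, from the difference of its row and column
    weights: 10 and 100 are large enough to exclude coincidences among
    differences of 0, +-1, +-10, +-100. *)
Definition sep_weight (r i j a : nat) : int :=
  let k n := if n == i then 10%:Z else
             if (n == j) || (n + j == 2 * r)%N then 100%:Z else 1%:Z in
  if (a < r)%N then k a else if a == r then 0 else - k (2 * r - a)%N.

Lemma sep_weight_odd r i j a : (a <= 2 * r)%N ->
  sep_weight r i j (2 * r - a) = - sep_weight r i j a.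
Proof.
move=> ar; rewrite /sep_weight subKn //.
case: (ltngtP a r) => [h | h | ->].
- by have [-> ->] : (2 * r - a < r)%N = false /\ (2 * r - a == r)%N = false by lia.
- by have -> : (2 * r - a < r)%N; [lia | rewrite opprK].
by have [-> ->] : (2 * r - r < r)%N = false /\ (2 * r - r == r)%N by lia.
Qed.

Lemma sep_weightP r i j a b :
  (i < j)%N -> (i + j < 2 * r)%N -> (a <= 2 * r)%N -> (b <= 2 * r)%N ->
  sep_weight r i j a - sep_weight r i j b
    = sep_weight r i j i - sep_weight r i j j ->
  (a = i /\ b = j) \/ (a = 2 * r - j /\ b = 2 * r - i)%N.
Proof.
move=> ij ij2 ar br.
have -> : sep_weight r i j i = 10 by rewrite /sep_weight eqxx; case: ifP; lia.
have -> : sep_weight r i j j =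
    if (j < r)%N then 100%:Z else if j == r then 0 else -100%:Z.
  by rewrite /sep_weight; repeat (case: ifP => ?); lia.
rewrite /sep_weight.
case: (ltngtP j r) => jr; case: (ltngtP a r) => ca; case: (ltngtP b r) => cb;
  by repeat (case: ifP => ?); lia.
Qed.

Section IdealRoots.
Variables (F : numFieldType) (r : nat).
Notation d := (2 * r).+1.
Variable (I : {vspace 'M[F]_d}).
Implicit Types (i j k l : 'I_d).

Lemma rootmx_borel i j : (i < j)%N -> rootmx F i j \in std_borel F d.
Proof.
move=> ij; rewrite memv_cap rootmx_skew; apply/support_spaceP => a b.
rewrite rootmxE /upper addn0; apply: contraR; rewrite -ltnNge => ba.
have -> : (a == i) && (b == j) = false.
  by apply/negbTE/andP => -[/eqP ea /eqP eb]; move: ba; rewrite ea eb; lia.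
have -> : (a == rev_ord j) && (b == rev_ord i) = false.
  by apply/negbTE/andP => -[/eqP ea /eqP eb]; move: ba; rewrite ea eb /=; lia.
by rewrite subrr.
Qed.

Hypothesis idI : lie_ideal (std_borel F d) I.

(** The component of x of the weight of (i, j) has only the entries at (i, j)
    and its reflection, so it is a multiple of the root vector. *)
Lemma ideal_root_component x i j : (i < j)%N -> (i + j < 2 * r)%N ->
  x \in I -> x i j != 0 -> rootmx F i j \in I.
Proof.
move=> ij ij2 Ix xij; pose h (a : 'I_d) : F := (sep_weight r i j a)%:~R.
have oddh a : h (rev_ord a) = - h a.
  rewrite /h -mulrNz -sep_weight_odd; last by have := ltn_ord a.
  by rewrite /= subSS.
have := ideal_weight_component idI (h i - h j) oddh Ix.
suff -> : \matrix_(a, b) (if h a - h b == h i - h j then x a b else 0)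
    = x i j *: rootmx F i j.
  by move/(rpredZ (x i j)^-1); rewrite scalerA mulVf // scale1r.
have sk : x \in skew_space F d.
  by have := subvP (proj1 idI) _ Ix; rewrite memv_cap => /andP[].
apply/matrixP => a b; rewrite mxE [RHS]mxE rootmxE /h -!rmorphB /= eqr_int.
have [/andP[/eqP-> /eqP->] | nab] := boolP ((a == i) && (b == j)).
  rewrite eqxx (_ : (i == rev_ord j) && _ = false) ?subr0 ?mulr1 //.
  by apply/negbTE/andP => -[/eqP/(congr1 val)/= e _]; lia.
have [/andP[/eqP-> /eqP->] | nab'] := boolP ((a == rev_ord j) && (b == rev_ord i)).
  rewrite (skew_spaceP _ sk) sub0r mulrN1 ifT //.
  have := oddh i; have := oddh j; rewrite /h -!mulrNz => /eqP.
  by rewrite eqr_int => /eqP-> /eqP; rewrite eqr_int => /eqP->; lia.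
rewrite subrr mulr0; case: eqP => // /(sep_weightP ij ij2).
have := ltn_ord a; have := ltn_ord b; rewrite !ltnS => hb ha.
case/(_ ha hb) => -[ea eb].
  by case/andP: nab; split; apply/eqP/val_inj.
by case/andP: nab'; split; apply/eqP/val_inj; rewrite /= subSS.
Qed.

Lemma ideal_root_up i j k : (k < i)%N -> (i < j)%N -> (i + j < 2 * r)%N ->
  rootmx F i j \in I -> rootmx F k j \in I.
Proof.
move=> ki ij ij2 /((proj2 idI) _ _ (rootmx_borel ki)); rewrite rootmx_bracket.
have -> : (k == j) = false by apply/negbTE/eqP => /(congr1 val) /=; lia.
have -> : (i == rev_ord j) = false by apply/negbTE/eqP => /(congr1 val) /=; lia.
have -> : (k == rev_ord i) = false by apply/negbTE/eqP => /(congr1 val) /=; lia.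
by rewrite eqxx !mulr0n !subr0 addr0.
Qed.

(** The case j + l = 2r is excluded because the root vector at (j, l) is then
    zero; [ideal_root_right] goes around it through column r. *)
Lemma ideal_root_right_step i j l : (i < j)%N -> (j < l)%N -> (i + l < 2 * r)%N ->
  (j + l)%N != (2 * r)%N -> rootmx F i j \in I -> rootmx F i l \in I.
Proof.
move=> ij jl il jl2 Iij.
have := (proj2 idI) _ _ (rootmx_borel jl) Iij; rewrite rootmx_bracket.
have -> : (l == i) = false by apply/negbTE/eqP => /(congr1 val) /=; lia.
have -> : (l == rev_ord j) = false by apply/negbTE/eqP => /(congr1 val) /=; lia.
have -> : (j == rev_ord i) = false by apply/negbTE/eqP => /(congr1 val) /=; lia.
by rewrite eqxx !mulr0n sub0r subr0 addr0 rpredN.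
Qed.

Lemma ideal_root_right i j l : (i < j)%N -> (j < l)%N -> (i + l < 2 * r)%N ->
  rootmx F i j \in I -> rootmx F i l \in I.
Proof.
move=> ij jl il Iij; have [jl2 | jl2] := eqVneq (j + l)%N (2 * r)%N; last first.
  exact: ideal_root_right_step ij jl il jl2 Iij.
pose mid : 'I_d := inord r.
have midE : mid = r :> nat by rewrite inordK // ltnS; lia.
by apply: (@ideal_root_right_step _ mid); last
  (apply: (@ideal_root_right_step _ j)); rewrite ?midE //; lia.
Qed.

Hypothesis abI : {in I &, forall x y, lie_bracket x y = 0}.

(** Otherwise row 0 also contains the position (0, 2r - l), and the bracket of
    its root vector with that of (1, l) is, up to sign, the root vector of the
    highest root, at (0, 2r - 1). *)
Lemma abelian_root_rows i k j l : i = 0%N :> nat -> k = 1%N :> nat ->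
  (i < j)%N -> (k < l)%N -> (i + j < 2 * r)%N -> (k + l < 2 * r)%N ->
  rootmx F i j \in I -> rootmx F k l \in I -> (2 * r < j + l)%N.
Proof.
move=> i0 k1 ij kl ij2 kl2 Iij Ikl; rewrite ltnNge; apply/negP => jl.
have Il : rootmx F i (rev_ord l) \in I.
  have [e|ne] := eqVneq j (rev_ord l); first by rewrite -e.
  apply: ideal_root_right Iij => //=; try lia.
  by move: ne; rewrite -val_eqE /=; lia.
have := abI Il Ikl; rewrite rootmx_bracket.
have -> : (rev_ord l == k) = false by apply/negbTE/eqP => /(congr1 val) /=; lia.
have -> : (i == l) = false by apply/negbTE/eqP => /(congr1 val) /=; lia.
have -> : (i == rev_ord k) = false by apply/negbTE/eqP => /(congr1 val) /=; lia.
rewrite eqxx !mulr0n subr0 sub0r addr0 mulr1n => /eqP; rewrite oppr_eq0 => /eqP.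
move/matrixP/(_ i (rev_ord k)); rewrite rootmxE rev_ordK !eqxx mxE.
have -> : (i == k) = false by apply/negbTE/eqP => /(congr1 val) /=; lia.
by rewrite /= subr0 => /eqP; rewrite oner_eq0.
Qed.
End IdealRoots.

(** * Abelian ideals and strict partitions *)

Definition strict_partition k (l : seq nat) := path gtn k.+1 l && (0%N \notin l).

Definition abelian_partition r (l : seq nat) :=
  strict_partition (2 * r).-1 l &&
  ((nth 0 l 1 == 0) || (nth 0 l 0 + nth 0 l 1 <= (2 * r).-2))%N.

Lemma strict_partition_nth0 k l : strict_partition k l -> (nth 0%N l 0 <= k)%N.
Proof. by case: l => //= a l /andP[/andP[]]. Qed.

Lemma strict_partition_decr k l i j : strict_partition k l ->
  (i < j)%N -> (0 < nth 0 l j)%N -> (nth 0 l j + (j - i) <= nth 0 l i)%N.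
Proof.
case/andP => /path_sorted/sortedP dec _.
have step a : (0 < nth 0 l a.+1)%N -> (nth 0 l a.+1 < nth 0 l a)%N.
  by move=> pos; apply: dec; rewrite ltnNge; apply: contraL pos => /(nth_default 0)->.
move=> ij; rewrite -(subnKC ij); move: (j - i.+1)%N => n {j ij}.
elim: n => [|n IHn] pos.
  by move: pos; rewrite addn0 => /step; rewrite subSnn addn1.
move: pos; rewrite addnS => pos; have := step _ pos.
have := IHn (leq_ltn_trans (leq0n _) (step _ pos)).
by lia.
Qed.

(** The positions filled by l, extended to the whole matrix: positions below
    the antidiagonal are read through the reflection, which sends (i, j) to
    (2r - j, 2r - i).  On the antidiagonal, where skew matrices vanish, the
    maximum with 1 keeps positions of empty rows out. *)
Definition in_shape r l i j :=
  (maxn 1 (maxn (2 * r - (i + j)) (i + j - 2 * r)) <= nth 0 l (minn i (2 * r - j)))%N.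

Section ShapeIdeals.
Variables (F : numFieldType) (r : nat).
Notation d := (2 * r).+1.
Implicit Types (l : seq nat) (i j : 'I_d) (x y : 'M[F]_d).

Definition shape_space l : {vspace 'M[F]_d} :=
  (skew_space F d :&: support_space F (fun i j : 'I_d => in_shape r l i j))%VS.

Lemma in_shape_flip l i j : in_shape r l (rev_ord j) (rev_ord i) = in_shape r l i j.
Proof.
have := ltn_ord i; have := ltn_ord j; rewrite /in_shape /= => hj hi.
by congr (maxn 1 _ <= nth _ _ _)%N; lia.
Qed.

Lemma rootmx_shape l i j : (i + j < 2 * r)%N ->
  (rootmx F i j \in shape_space l) = in_shape r l i j.
Proof.
move=> ij; rewrite memv_cap rootmx_skew /=.
apply/support_spaceP/idP => [/(_ i j) | lij a b].
  rewrite rootmxE !eqxx (_ : (i == rev_ord j) = false) ?subr0 ?oner_eq0 //.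
    by apply.
  by apply/negbTE/eqP => /(congr1 val) /=; lia.
rewrite rootmxE; have [/andP[/eqP-> /eqP->] // | _] := boolP ((a == i) && (b == j)).
have [/andP[/eqP-> /eqP->] _ | _] := boolP (_ && _); first by rewrite in_shape_flip.
by rewrite subrr eqxx.
Qed.

Lemma shape_spaceP l x : x \in skew_space F d ->
  (forall i j, (i + j < 2 * r)%N -> x i j != 0 -> in_shape r l i j) ->
  x \in shape_space l.
Proof.
move=> sk xl; apply: skew_mem sk _ => i j; rewrite ltnS => ij xij.
by rewrite rootmx_shape // xl.
Qed.

Lemma shape_entry l x i j : x \in shape_space l -> x i j != 0 ->
  (i + j != 2 * r)%N /\ in_shape r l i j.
Proof.
rewrite memv_cap => /andP[sk /support_spaceP xl] xij; split; last exact: xl.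
by apply: contraNneq xij => e; rewrite (skew_antidiag0 sk) // e.
Qed.

Lemma free_rootmx (s : seq ('I_d * 'I_d)) : uniq s ->
  (forall ij, ij \in s -> ij.1 + ij.2 < 2 * r)%N ->
  free [seq rootmx F ij.1 ij.2 | ij <- s].
Proof.
elim: s => [|[i j] s IHs] /=; first by rewrite nil_free.
case/andP=> nij us sr; rewrite free_cons IHs ?andbT => // [|ij ijs]; last first.
  by apply: sr; rewrite inE ijs orbT.
have ij2 : (i + j < 2 * r)%N by apply: (sr (i, j)); rewrite inE eqxx.
have entry (k m : 'I_d) :
    (k + m < 2 * r)%N -> rootmx F k m i j = ((i == k) && (j == m))%:R.
  move=> km; rewrite rootmxE (_ : (i == rev_ord m) && _ = false) ?subr0 //.
  apply/negbTE/andP => -[/eqP/(congr1 val)/= e1 /eqP/(congr1 val)/= e2].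
  by have := ltn_ord k; have := ltn_ord m; lia.
pose W := support_space F (fun a b : 'I_d => (a, b) != (i, j)).
apply: (contra (subvP (V := W) _ _)); last first.
  apply/negP => /support_spaceP/(_ i j).
  by rewrite entry // !eqxx oner_eq0 => /(_ isT)/eqP.
apply/span_subvP => _ /mapP[[k m] kms ->]; apply/support_spaceP => a b.
apply: contra => /eqP[-> ->] /=; rewrite entry; last first.
  by apply: (sr (k, m)); rewrite inE kms orbT.
rewrite -xpair_eqE; have [e|_] := eqVneq (i, j) (k, m); last exact: eqxx.
by rewrite e kms in nij.
Qed.

Section AbelianPartition.
Variables (l : seq nat) (part_l : abelian_partition r l).

Let strict_l : strict_partition (2 * r).-1 l. Proof. by case/andP: part_l. Qed.

Let bound01 : (0 < nth 0 l 1 -> nth 0 l 0 + nth 0 l 1 <= (2 * r).-2)%N.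
Proof. by case/andP: part_l => _ /orP[/eqP->|]. Qed.

Let decr a b :
  (a < b)%N -> (0 < nth 0 l b)%N -> (nth 0 l b + (b - a) <= nth 0 l a)%N.
Proof. exact: strict_partition_decr strict_l. Qed.

(** If l_1 > 0, then l_0 > l_1 and l_0 + l_1 <= 2r - 2 give l_1 <= r - 2,
    hence l_i <= r - 1 - i for the nonempty rows i >= 1; and l_0 <= 2r - 1.
    So no row reaches the diagonal. *)
Lemma shape_upper i j : in_shape r l i j -> (i < j)%N.
Proof.
rewrite /in_shape; set p := minn _ _ => lij.
have := strict_partition_nth0 strict_l.
have := @decr 0 p; have := @decr 1 p; have := @decr 0 1; have := bound01.
have := ltn_ord i; have := ltn_ord j; have pE : p = minn i (2 * r - j) by [].
case: (ltngtP p 1) => p1; last 2 first.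
- by lia.
- by move: lij; rewrite p1; lia.
have p0 : p = 0%N by lia.
by move: lij; rewrite p0; lia.
Qed.

Lemma shape_ideal : lie_ideal (std_borel F d) (shape_space l).
Proof.
split.
  apply: capvS => //; apply/subvP => x /support_spaceP xl; apply/support_spaceP.
  by move=> i j /xl/shape_upper; rewrite /upper addn0 => /ltnW.
move=> x y; rewrite memv_cap => /andP[xs /support_spaceP xu] yl.
have ys : y \in skew_space F d by move: yl; rewrite memv_cap => /andP[].
apply: shape_spaceP; first exact: skew_space_bracket.
move=> i j ij; apply: contraR => nij.
suff [xy yx] : (x *m y) i j = 0 /\ (y *m x) i j = 0.
  by rewrite mxE [X in _ + X]mxE xy yx subrr.
split; rewrite mxE big1 // => k _; apply/eqP; apply: contraR nij;
  rewrite mulf_eq0 negb_or => /andP[].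
  move=> /xu; rewrite /upper addn0 => ik /(shape_entry yl)[kj].
  have := ltn_ord k; have := ltn_ord j; rewrite /in_shape.
  set p := minn k _; have pE : p = minn k (2 * r - j) by [].
  have := @decr i p; have -> : minn i (2 * r - j) = i by lia.
  have [ip | ip] := ltnP i p; first by lia.
  have <- : p = i by lia.
  by lia.
move=> /(shape_entry yl)[ik lik] /xu; rewrite /upper addn0 => kj.
by move: lik; rewrite /in_shape !(minn_idPl _); lia.
Qed.

(** A nonzero term x_ik y_kj would need, after reflecting (k, j) if necessary
    to a position in row p > i, at least 2r - k entries in row 0 and k - 1 in
    row 1, against the bound on l_0 + l_1. *)
Lemma shape_product0 x y i j : x \in shape_space l -> y \in shape_space l ->
  (i + j < 2 * r)%N -> (x *m y) i j = 0.
Proof.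
move=> xl yl ij; rewrite mxE big1 // => k _; apply/eqP; apply: contraTT isT.
rewrite mulf_eq0 negb_or => /andP[/(shape_entry xl)[_ lik] /(shape_entry yl)[kj lkj]].
have ik := shape_upper lik; have kj' := shape_upper lkj; have := ltn_ord j.
move: lik lkj; rewrite /in_shape; have -> : minn i (2 * r - k) = i by lia.
set p := minn k _; have pE : p = minn k (2 * r - j) by [].
have ip : (i < p)%N by lia.
rewrite !geq_max => /and3P[lami1 lami _] /and3P[lamp1 lamp lamp'].
have lam0 : (2 * r - k <= nth 0 l 0)%N.
  have [i0|i0] := posnP i; first by move: lami; rewrite i0; lia.
  by have := decr i0 lami1; lia.
have lam1 : (nth 0 l p + (p - 1) <= nth 0 l 1)%N.
  have [p1|p1] := ltnP 1 p; first exact: decr.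
  have -> : p = 1%N by lia.
  by rewrite addn0.
have := bound01 (leq_trans lamp1 (leq_trans (leq_addr _ _) lam1)); lia.
Qed.

Lemma shape_abelian : {in shape_space l &, forall x y, lie_bracket x y = 0}.
Proof.
move=> x y xl yl; apply/eqP; rewrite -memv0.
have sk z : z \in shape_space l -> z \in skew_space F d.
  by rewrite memv_cap => /andP[].
apply: skew_mem => [|i j]; first by rewrite skew_space_bracket ?sk.
by rewrite ltnS => ij; rewrite mxE [X in _ + X]mxE !shape_product0 // subrr eqxx.
Qed.

Lemma dim_shape_space : \dim (shape_space l) = sumn l.
Proof.
pose pos := [seq (p, 2 * r - p - c.+1)%N
  | p <- iota 0 (size l), c <- iota 0 (nth 0%N l p)].
pose ord2 (pq : nat * nat) : 'I_d * 'I_d := (inord pq.1, inord pq.2).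
pose X := [seq rootmx F ij.1 ij.2 | ij <- map ord2 pos].
have rowP p c : c \in iota 0 (nth 0%N l p) -> (p + c.+1 < 2 * r)%N.
  rewrite mem_iota /= add0n => hc.
  have pos_p : (0 < nth 0 l p)%N by apply: leq_ltn_trans hc.
  have := strict_partition_nth0 strict_l.
  by case: (posnP p) hc pos_p => [->|p0] hc pos_p; [lia | have := decr p0 pos_p; lia].
have posP p q : (p, q) \in pos ->
    [/\ p < size l, p + q < 2 * r & 2 * r - (p + q) <= nth 0 l p]%N.
  case/allpairsPdep => p' [c []]; rewrite !mem_iota !add0n /= => hp hc [-> ->].
  have pos_p : (0 < nth 0 l p')%N by apply: leq_ltn_trans hc.
  have := @decr 0 p'; have := strict_partition_nth0 strict_l.
  case: (posnP p') hc pos_p hp => [->|p0] hc pos_p hp; split; lia.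
have posI (i j : 'I_d) : (i + j < 2 * r)%N -> in_shape r l i j ->
    (i, j) \in map ord2 pos.
  move=> ij lij; apply/mapP; exists (i : nat, j : nat); last first.
    by rewrite /ord2 /= !inord_val.
  move: lij; rewrite /in_shape (minn_idPl _); last by lia.
  move=> lij; apply/allpairsPdep; exists (i : nat), (2 * r - (i + j)).-1.
  rewrite !mem_iota !add0n /=; split; [|by lia|by congr pair; lia].
  by rewrite ltnNge; apply/negP => /(nth_default 0%N) e; rewrite e in lij; lia.
have ord2E pq : pq \in pos -> (ord2 pq).1 = pq.1 :> nat /\ (ord2 pq).2 = pq.2 :> nat.
  by case: pq => p q /posP[_ pq _]; rewrite /= !inordK //; lia.
have freeX : free X.
  apply: free_rootmx => [|_ /mapP[pq /[dup] pqs /ord2E[e1 e2] ->]]; last first.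
    by rewrite e1 e2; case: pq pqs {e1 e2} => p q /posP[].
  rewrite map_inj_in_uniq => [|pq pq' /ord2E[e1 e2] /ord2E[e1' e2'] e]; last first.
    by rewrite [pq]surjective_pairing [pq']surjective_pairing -e1 -e2 -e1' -e2' e.
  apply: allpairs_uniq_dep => [|p _|[p c] [p' c']]; rewrite ?iota_uniq //.
  move=> /allpairsPdep[a [b [_ hb [-> ->]]]] /allpairsPdep[a' [b' [_ hb' [-> ->]]]].
  move=> /= [ea] eb; rewrite -ea in eb hb' *; congr existT.
  by have := rowP _ _ hb; have := rowP _ _ hb'; lia.
have sizeX : size X = sumn l.
  rewrite !size_map size_allpairs_dep; congr sumn.
  under eq_map => p do rewrite size_iota.
  exact: (mkseq_nth 0%N l).
rewrite -sizeX -(eqnP freeX); congr (\dim _); apply/eqP; rewrite eqEsubv.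
apply/andP; split; last first.
  apply/span_subvP => _ /mapP[_ /mapP[pq /[dup] pqs /ord2E[e1 e2] ->] ->].
  have := pqs; rewrite [pq]surjective_pairing => /posP[_ pq2 pql].
  rewrite rootmx_shape e1 e2 // /in_shape (minn_idPl _); lia.
apply/subvP => x xl; apply: skew_mem => [|i j].
  by move: xl; rewrite memv_cap => /andP[].
rewrite ltnS => ij /(shape_entry xl)[_ lij]; apply: memv_span.
by apply/mapP; exists (i, j); rewrite // posI.
Qed.

End AbelianPartition.
End ShapeIdeals.

Lemma strict_partition_ext k k' l l' : strict_partition k l -> strict_partition k' l' ->
  nth 0%N l =1 nth 0%N l' -> l = l'.
Proof.
have size_le k1 k2 l1 l2 : strict_partition k1 l1 -> strict_partition k2 l2 ->
    nth 0%N l1 =1 nth 0%N l2 -> (size l1 <= size l2)%N.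
  move=> /andP[_ n1] _ e; rewrite leqNgt; apply: contra n1 => lt12.
  by rewrite -(nth_default 0%N (leqnn (size l2))) -e mem_nth.
move=> sl sl' e; apply: (@eq_from_nth _ 0%N) => [|i _]; last exact: e.
by apply/eqP; rewrite eqn_leq (size_le _ _ _ _ sl sl') // (size_le _ _ _ _ sl' sl).
Qed.

Section Classification.
Variables (F : numFieldType) (r : nat).
Notation d := (2 * r).+1.

Lemma shape_space_inj l l' : abelian_partition r l -> abelian_partition r l' ->
  shape_space F r l = shape_space F r l' -> l = l'.
Proof.
have nth_le l1 l2 p : abelian_partition r l1 ->
    shape_space F r l1 = shape_space F r l2 -> (nth 0 l1 p <= nth 0 l2 p)%N.
  move=> /andP[s1 _] e; have [-> //|pos] := posnP (nth 0%N l1 p).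
  have pc : (p + nth 0 l1 p < 2 * r)%N.
    have := strict_partition_nth0 s1; have := @strict_partition_decr _ _ 0 p s1.
    by case: (posnP p) pos => [->|p0] pos; [lia | move=> /(_ isT pos); lia].
  set c := nth 0%N l1 p in pos pc *.
  pose i : 'I_d := inord p; pose j : 'I_d := inord (2 * r - p - c).
  have iE : i = p :> nat by rewrite inordK //; lia.
  have jE : j = (2 * r - p - c)%N :> nat by rewrite inordK //; lia.
  have minE : minn i (2 * r - j) = p by lia.
  have ij : (i + j < 2 * r)%N by lia.
  have : in_shape r l1 i j by rewrite /in_shape minE -/c; lia.
  by rewrite -(rootmx_shape F) // e rootmx_shape // /in_shape minE; lia.
move=> pl pl' e; have [/andP[sl _] /andP[sl' _]] := (pl, pl').
apply: strict_partition_ext sl sl' _ => p; apply/eqP.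
by rewrite eqn_leq !nth_le.
Qed.

Section Rows.
Variable I : {vspace 'M[F]_d}.
Hypothesis abI : abelian_ideal (std_borel F d) I.

Let idI : lie_ideal (std_borel F d) I. Proof. by case: abI. Qed.

(* counting columns from the right turns closure of I under moving right into
   downward closure of Q in c *)
Let Q p c := [&& 0 < c, c + 2 * p < 2 * r &
  rootmx F (inord p : 'I_d) (inord (2 * r - p - c)) \in I]%N.

Let row_len p := find (fun c => ~~ Q p c.+1) (iota 0 (2 * r)).

Let Q_down p c : Q p c.+2 -> Q p c.+1.
Proof.
case/and3P=> _ cp Ic; apply/and3P; split => //; first by lia.
by apply: ideal_root_right Ic => //; rewrite ?inordK //; lia.
Qed.

Let Q_le p c c' : (c <= c')%N -> Q p c'.+1 -> Q p c.+1.
Proof.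
move=> /subnKC <-; elim: (c' - c)%N => [|n IHn]; first by rewrite addn0.
by rewrite addnS => /Q_down.
Qed.

Let row_lenP p c : (c < row_len p)%N = Q p c.+1.
Proof.
apply/idP/idP => [lt_c | Qc].
  have c2 : (c < 2 * r)%N.
    by apply: leq_trans lt_c _; rewrite -[X in (_ <= X)%N](size_iota 0) find_size.
  by have := before_find 0%N lt_c; rewrite nth_iota // => /negbFE.
rewrite ltnNge; apply/negP => le_c.
have c2 : (c < 2 * r)%N by case/and3P: Qc => _ h _; lia.
have has_p : has (fun c => ~~ Q p c.+1) (iota 0 (2 * r)).
  by rewrite has_find size_iota; apply: leq_ltn_trans c2.
have := nth_find 0%N has_p; rewrite nth_iota ?add0n; last first.
  exact: leq_ltn_trans le_c c2.
by rewrite (Q_le le_c).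
Qed.

Let row_len_decr p : (0 < row_len p.+1)%N -> (row_len p.+1 < row_len p)%N.
Proof.
case e : (row_len p.+1) => [//|c] _; rewrite row_lenP.
have /and3P[_ cp Ic] : Q p.+1 c.+1 by rewrite -row_lenP e.
apply/and3P; split => //; first by lia.
have -> : (2 * r - p - c.+2 = 2 * r - p.+1 - c.+1)%N by lia.
by apply: ideal_root_up Ic => //; rewrite ?inordK //; lia.
Qed.

Let row_len_shape (i j : 'I_d) : (i + j < 2 * r)%N ->
  (2 * r - (i + j) <= row_len i)%N = ((i < j)%N && (rootmx F i j \in I)).
Proof.
move=> ij; case e : (2 * r - (i + j))%N => [|c]; first by lia.
rewrite row_lenP /Q /=.
have -> : (2 * r - i - c.+1 = j)%N by lia.
by rewrite !inord_val; congr (_ && _); lia.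
Qed.

(** The partition consists of the row lengths up to the first empty row. *)
Lemma abelian_ideal_shape : exists2 l, abelian_partition r l & I = shape_space F r l.
Proof.
pose k := find (fun p => row_len p == 0%N) (iota 0 r.+1).
have row_r : row_len r = 0%N.
  by apply/eqP; rewrite -leqn0 leqNgt row_lenP; apply/negP => /and3P[_ h _]; lia.
have has0 : has (fun p => row_len p == 0%N) (iota 0 r.+1).
  by apply/hasP; exists r; rewrite ?row_r // mem_iota; lia.
have kr : (k < r.+1)%N by rewrite -(size_iota 0 r.+1) -has_find.
have rowk : row_len k = 0%N.
  by have := nth_find 0%N has0; rewrite nth_iota // => /eqP.
have row_gt p : (k <= p)%N -> row_len p = 0%N.
  elim: p => [|p IHp]; first by rewrite leqn0 => /eqP e; rewrite -e rowk.
  rewrite leq_eqVlt => /orP[/eqP<- // | /IHp e0].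
  by have := @row_len_decr p; rewrite e0; lia.
have row_lt p : (p < k)%N -> (0 < row_len p)%N.
  move=> pk; have := before_find 0%N pk; rewrite nth_iota; last by lia.
  by rewrite add0n lt0n => ->.
pose l := mkseq row_len k.
have nthl p : nth 0%N l p = row_len p.
  have [pk|pk] := ltnP p k; first by rewrite nth_mkseq.
  by rewrite nth_default ?size_mkseq // row_gt.
have part_l : abelian_partition r l.
  apply/andP; split; first (apply/andP; split).
  - apply/(pathP 0%N) => -[|p]; rewrite size_mkseq => pk /=; rewrite !nthl /=.
      have := row_lt _ pk; case e : (row_len 0) => [//|c] _.
      have /and3P[_ h _] : Q 0 c.+1 by rewrite -row_lenP e.
      by lia.
    exact/row_len_decr/row_lt.
  - apply/negP => /mapP[p]; rewrite mem_iota add0n => /andP[_ /row_lt].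
    by move=> h e; rewrite -e in h.
  rewrite !nthl; have [-> //|pos] := posnP (row_len 1).
  apply/orP; right; have lt10 := row_len_decr pos.
  have rowQ p : (0 < row_len p)%N -> Q p (row_len p).
    by case e : (row_len p) => [//|c] _; rewrite -row_lenP e.
  have /and3P[_ c0 I0] := rowQ _ (leq_ltn_trans (leq0n _) lt10).
  have /and3P[_ c1 I1] := rowQ _ pos.
  have : (2 * r < (inord (2 * r - 0 - row_len 0) : 'I_d)
                  + (inord (2 * r - 1 - row_len 1) : 'I_d))%N.
    by apply: (abelian_root_rows idI abI.2 _ _ _ _ _ _ I0 I1); rewrite !inordK //; lia.
  by rewrite !inordK; lia.
exists l => //; apply/vspaceP => x.
have shapeE (i j : 'I_d) : (i + j < 2 * r)%N ->
    in_shape r l i j = (i < j)%N && (rootmx F i j \in I).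
  move=> ij; rewrite -row_len_shape // /in_shape nthl.
  have -> : minn i (2 * r - j) = i by lia.
  by lia.
have sI y : y \in I -> y \in std_borel F d by apply: subvP (proj1 idI) _.
apply/idP/idP => [Ix | xl].
  have := sI _ Ix; rewrite memv_cap => /andP[sk /support_spaceP xu].
  apply: shape_spaceP => // i j ij xij; rewrite shapeE //.
  have lt_ij : (i < j)%N.
    have := xu i j xij; rewrite /upper addn0 leq_eqVlt => /orP[/eqP/val_inj e|//].
    by case/eqP: xij; rewrite -e (abelian_ideal_diag0 abI).
  by rewrite lt_ij (ideal_root_component idI _ _ Ix).
apply: skew_mem => [|i j]; first by move: xl; rewrite memv_cap => /andP[].
by rewrite ltnS => ij /(shape_entry xl)[_]; rewrite shapeE // => /andP[].
Qed.
End Rows.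
End Classification.

(** * The generating polynomial *)

Fixpoint strict_partitions k : seq (seq nat) :=
  if k is k'.+1 then
    strict_partitions k' ++ [seq k :: l | l <- strict_partitions k']
  else [:: [::]].

Lemma mem_strict_partitions k l : (l \in strict_partitions k) = strict_partition k l.
Proof.
elim: k l => [|k IHk] l /=.
  rewrite inE; case: l => // a l; rewrite /strict_partition /= inE.
  by case: a => [|a]; rewrite ?orbT ?andbF.
rewrite mem_cat IHk; case: l => [|a l].
  by rewrite /strict_partition.
have -> : (a :: l \in [seq k.+1 :: l' | l' <- strict_partitions k]) =
    (a == k.+1) && strict_partition k l.
  by rewrite -IHk; apply/mapP/andP => [[l' ? [-> ->]] | [/eqP-> ?]]; [|exists l].
rewrite /strict_partition /= !inE [(a < k.+2)%N]ltnS.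
case: (ltngtP a k.+1) => [ak|ak|->] //=.
by rewrite orbF.
Qed.

Lemma uniq_strict_partitions k : uniq (strict_partitions k).
Proof.
elim: k => //= k IHk; rewrite cat_uniq IHk map_inj_uniq ?IHk ?andbT; last first.
  by move=> l l' [].
apply/hasPn => _ /mapP[l _ ->]; rewrite mem_strict_partitions /strict_partition /=.
by rewrite ltnn.
Qed.

Lemma strict_partitions_gen k :
  \sum_(l <- strict_partitions k) 'X^(sumn l)
    = \prod_(1 <= j < k.+1) (1 + 'X^j) :> {poly nat}.
Proof.
elim: k => [|k IHk] /=; first by rewrite big_seq1 big_geq.
rewrite big_cat big_map /= [RHS]big_nat_recr //= -IHk mulrDr mulr1; congr (_ + _).
by rewrite mulrC mulr_sumr; apply: eq_bigr => l _; rewrite exprD.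
Qed.

Lemma strict_partitionE k l : strict_partition k l =
  [&& sorted gtn l, 0%N \notin l & nth 0%N l 0 <= k]%N.
Proof.
case: l => [|a l]; rewrite /strict_partition //= ltnS.
by rewrite andbC andbA [in RHS]andbC; case: (a <= k)%N; rewrite ?andbF //= ?andbT andbC.
Qed.

Lemma strict_partition_cons k a l : strict_partition k (a :: l) =
  [&& 0 < a, a <= k & strict_partition a.-1 l]%N.
Proof.
rewrite /strict_partition /= inE negb_or ltnS; case: a => [|a]; first by rewrite !andbF.
by rewrite /= andbA.
Qed.

(** One list for each of the three summands of the polynomial. *)
Definition abelian_partitions r : seq (seq nat) :=
  [:: (2 * r).-1]%N ::
    [seq (2 * r - k - 2)%N :: l | k <- iota 0 r.-1, l <- strict_partitions k]
    ++ strict_partitions r.-1.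

Lemma mem_abelian_partitions r l : (1 < r)%N ->
  (l \in abelian_partitions r) = abelian_partition r l.
Proof.
move=> r1; rewrite inE mem_cat mem_strict_partitions /abelian_partition.
case: l => [|a l]; first by rewrite orbT /strict_partition.
have -> : (a :: l \in [seq (2 * r - k - 2)%N :: l' | k <- iota 0 r.-1,
      l' <- strict_partitions k]) =
    [&& (r <= a)%N, (a <= (2 * r).-2)%N & strict_partition ((2 * r).-2 - a) l].
  apply/allpairsPdep/and3P => [[k [l' []]] | [ra ar sl]].
    rewrite mem_iota mem_strict_partitions add0n => /andP[_ kr] sl [-> ->].
    have -> : ((2 * r).-2 - (2 * r - k - 2) = k)%N by lia.
    by split => //; lia.
  exists ((2 * r).-2 - a)%N, l; rewrite mem_iota mem_strict_partitions.
  by split=> //; [lia | congr cons; lia].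
rewrite strict_partition_cons [strict_partition _ l]strict_partitionE.
rewrite strict_partition_cons ![strict_partition _ l]strict_partitionE.
have -> : (a :: l == [:: (2 * r).-1]) =
    [&& a == (2 * r).-1, sorted gtn l, 0%N \notin l & nth 0%N l 0 == 0%N].
  rewrite eqseq_cons; congr (_ && _); case: l => //= b l.
  rewrite inE; case: b => [|b] /=; first by rewrite andbF.
  by rewrite !andbF; case: eqP.
have -> : nth 0%N (a :: l) 0 = a by [].
have -> : nth 0%N (a :: l) 1 = nth 0%N l 0 by [].
by case: (sorted _ _); case: (0%N \notin l); lia.
Qed.

Lemma uniq_abelian_partitions r : (1 < r)%N -> uniq (abelian_partitions r).
Proof.
move=> r1; rewrite cons_uniq mem_cat cat_uniq uniq_strict_partitions andbT negb_or.
rewrite mem_strict_partitions strict_partition_cons.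
apply/andP; split; [apply/andP; split|apply/andP; split].
- by apply/negP => /allpairsPdep[k [l []]]; rewrite mem_iota => ? _ []; lia.
- by lia.
- apply: allpairs_uniq_dep => [|k _|[k l] [k' l']]; rewrite ?iota_uniq //.
    exact: uniq_strict_partitions.
  move=> /allpairsPdep[a [b [ha _ [-> ->]]]] /allpairsPdep[a' [b' [ha' _ [-> ->]]]].
  move: ha ha'; rewrite !mem_iota /= => ha ha' [ea ->]; congr existT; lia.
apply/hasPn => l; rewrite mem_strict_partitions => sl.
apply/negP => /allpairsPdep[k [l' [hk _ el]]].
by move: sl hk; rewrite el strict_partition_cons mem_iota; lia.
Qed.

Lemma abelian_partitions_gen r : (0 < r)%N ->
  \sum_(l <- abelian_partitions r) 'X^(sumn l) = fB r :> {poly nat}.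
Proof.
move=> r0; rewrite big_cons big_cat /= strict_partitions_gen prednK // addrA /fB.
congr (_ + _ + _); first by rewrite addn0 subn1.
rewrite big_allpairs_dep /= /index_iota subn0; apply: eq_bigr => k _.
by rewrite -strict_partitions_gen mulr_sumr; apply: eq_bigr => l _; rewrite exprD.
Qed.

Lemma gen_coef (T : Type) (w : T -> nat) (s : seq T) m :
  (\sum_(x <- s) 'X^(w x) : {poly nat})`_m = size [seq x <- s | w x == m].
Proof.
elim: s => [|x s IHs]; first by rewrite big_nil coef0.
by rewrite big_cons coefD coefXn IHs /= eq_sym; case: eqP.
Qed.

Lemma gen_fB_coef r m : (1 < r)%N ->
  (fB r)`_m = size [seq l <- abelian_partitions r | sumn l == m].
Proof. by move=> r1; rewrite -abelian_partitions_gen ?gen_coef // ltnW. Qed.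

(** Conjugation carries the enumeration of the abelian ideals of the
    triangular model over to b. *)
Lemma abelian_ideals_enum (F : numClosedFieldType) r
    (b : {vspace 'M[F]_((2 * r).+1)}) m :
  (1 < r)%N -> borel_subalgebra (orthogonal_lie F (2 * r).+1) b ->
  exists s : seq {vspace 'M[F]_((2 * r).+1)}, [/\ uniq s, size s = (fB r)`_m &
    forall I, I \in s <-> abelian_ideal b I /\ \dim I = m].
Proof.
move=> r1 borel_b; have [P uP bE] := borel_conj borel_b.
have uV : invmx P \in unitmx by rewrite unitmx_inv.
have bE' : b = (conj_by (invmx P) @: std_borel F (2 * r).+1)%VS.
  by rewrite -bE conjK_img.
pose L := [seq l <- abelian_partitions r | sumn l == m].
have LP l : (l \in L) = (abelian_partition r l && (sumn l == m)).
  by rewrite mem_filter mem_abelian_partitions // andbC.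
exists [seq (conj_by (invmx P) @: shape_space F r l)%VS | l <- L]; split.
- rewrite map_inj_in_uniq ?filter_uniq ?uniq_abelian_partitions //.
  move=> l l'; rewrite !LP => /andP[pl _] /andP[pl' _] e.
  apply: (shape_space_inj (F := F) pl pl').
  by rewrite -[LHS](conjVK_img _ uP) e conjVK_img.
- by rewrite size_map gen_fB_coef.
move=> I; split => [/mapP[l] | [abI dimI]].
  rewrite LP => /andP[pl /eqP <-] ->; split; last first.
    by rewrite dim_conj // dim_shape_space.
  rewrite bE'; apply: conj_abelian_ideal => //.
  by split; [exact: shape_ideal | exact: shape_abelian].
have := conj_abelian_ideal uP abI; rewrite bE => /abelian_ideal_shape[l pl Il].
apply/mapP; exists l; last by rewrite -Il conjK_img.
by rewrite LP pl -(dim_shape_space F pl) -Il dim_conj // dimI eqxx.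
Qed.

Local Open Scope classical_set_scope.
Local Open Scope card_scope.
Local Open Scope complex_scope.

Theorem proposition4p4 (R : realType) (r : nat) (hr : (3 <= r)%N)
    (b : {vspace 'M[R[i]]_(2 * r + 1)})
    (hb : borel_subalgebra (orthogonal_lie R[i] (2 * r + 1)) b) (m : nat) :
  [set I : {vspace 'M[R[i]]_(2 * r + 1)} | abelian_ideal b I /\ \dim I = m]
    #= `I_((fB r)`_m)%R.
Proof.
move: b hb; rewrite addn1 => b hb.
have [s [us <- sP]] := abelian_ideals_enum m (ltnW hr) hb.
have -> : [set I | abelian_ideal b I /\ \dim I = m] = nth 0%VS s @` `I_(size s).
  apply/seteqP; split=> I /=; rewrite -sP.
    by move=> Is; exists (index I s); rewrite ?nth_index //= index_mem.
  by case=> i /= lt_i <-; apply: mem_nth.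
apply: inj_card_eq => i j; rewrite !inE /= => lt_i lt_j /eqP.
by rewrite nth_uniq // => /eqP.
Qed.
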